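(* Let $G$ be a countably infinite group. Assume that $h^{\mathrm{Rok}}_G(L^G,\lambda^G) = \mathrm{H}(L,\lambda)$ for all standard probability spaces $(L,\lambda)$. Then every Bernoulli shift over $G$ has completely positive Rokhlin entropy.
   Context: Null sets are ignored throughout. A standard probability space is a standard Borel space with a Borel probability measure. For a standard probability space $(L,\lambda)$, the Bernoulli shift over $G$ with base $(L,\lambda)$ is the product space $(L^G,\lambda^G)$ with the action $(g\cdot x)(h) = x(g^{-1}h)$. $\mathrm{H}(L,\lambda) = \sum_{\ell\in L}-\lambda(\ell)\log\lambda(\ell)$ if $\lambda$ has countable support, and $\mathrm{H}(L,\lambda)=\infty$ otherwise. For an ergodic p.m.p. action $G\curvearrowright(X,\mu)$, the Rokhlin entropy is $h^{\mathrm{Rok}}_G(X,\mu) = \inf\{\mathrm{H}(\alpha)\}$, the infimum being over countable Borel partitions $\alpha$ that are generating (the smallest $G$-invariant $\sigma$-algebra containing $\alpha$ and the null sets is $\mathcal{B}(X)$), where $\mathrm{H}(\alpha)=\sum_{A\in\alpha}-\mu(A)\log\mu(A)$. An ergodic action $G\curvearrowright(X,\mu)$ has completely positive Rokhlin entropy if every factor $G\curvearrowright(Y,\nu)$ of it, with $Y$ not essentially a single point, satisfies $h^{\mathrm{Rok}}_G(Y,\nu)>0$. *)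

(* Defs.v *)
From HB Require Import structures.
From mathcomp Require Import all_boot all_order all_algebra.
From mathcomp Require Import all_classical all_reals all_analysis.

Set Implicit Arguments.
Unset Strict Implicit.
Unset Printing Implicit Defensive.

Import Order.TTheory GRing.Theory Num.Theory.
Import numFieldNormedType.Exports.

Local Open Scope classical_set_scope.
Local Open Scope ring_scope.

(* A Borel space isomorphic to that of a separable complete metric space. *)
Definition standard_borel (R : realType) d (T : measurableType d) : Prop :=
  exists (M : metricType R) (f : T -> M),
    [/\ forall F : set_system M, ProperFilter F -> cauchy F ->
        exists x : M, F --> x,
        exists2 D : set M, countable D & dense D,
        bijective f &
        forall A : set T, measurable A <-> <<s @open M >> (f @` A)].

Definition is_pmp_action (G : groupType) (R : realType) d
    (X : measurableType d) (mu : probability X R) (a : G -> X -> X) : Prop :=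
  [/\ forall x, a 1%g x = x,
      forall g h x, a (g * h)%g x = a g (a h x),
      forall g, measurable_fun setT (a g) &
      forall g A, measurable A -> mu (a g @^-1` A) = mu A].

Definition ergodic (G : groupType) (R : realType) d
    (X : measurableType d) (mu : probability X R) (a : G -> X -> X) : Prop :=
  forall A, measurable A -> (forall g, a g @^-1` A = A) ->
    mu A = 0%E \/ mu A = 1%E.

(* [ln 0 = 0], so the term vanishes at [p = 0]. *)
Definition entropy_term (R : realType) (p : \bar R) : \bar R :=
  (- (fine p * ln (fine p)))%:E.

Definition partition_entropy (R : realType) d (X : measurableType d)
    (mu : probability X R) (alpha : set (set X)) : \bar R :=
  (\esum_(A in alpha) entropy_term (mu A))%E.

Definition base_entropy (R : realType) d (L : measurableType d)
    (lambda : probability L R) : \bar R :=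
  if `[< exists C, [/\ countable C, measurable C & lambda C = 1%E] >]
  then (\esum_(l in [set: L]) entropy_term (lambda [set l]))%E
  else +oo%E.

Definition countable_borel_partition d (X : measurableType d)
    (alpha : set (set X)) : Prop :=
  [/\ countable alpha, alpha `<=` measurable & partition alpha id setT].

Definition invariant_sigma_algebra (G : groupType) (X : Type)
    (a : G -> X -> X) (S : set (set X)) : Prop :=
  sigma_algebra setT S /\ forall g A, S A -> S (a g @` A).

Definition generating (G : groupType) (R : realType) d
    (X : measurableType d) (mu : probability X R) (a : G -> X -> X)
    (alpha : set (set X)) : Prop :=
  smallest (invariant_sigma_algebra a)
    (alpha `|` [set N | measurable N /\ mu N = 0%E]) = d.-measurable.

Definition rokhlin_entropy (G : groupType) (R : realType) d
    (X : measurableType d) (mu : probability X R) (a : G -> X -> X) : \bar R :=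
  ereal_inf [set partition_entropy mu alpha | alpha in
    [set alpha | countable_borel_partition alpha /\ generating mu a alpha]].

(* Null sets are ignored: a factor map is equivariant almost everywhere. *)
Definition is_factor_map (G : groupType) (R : realType)
    d (X : measurableType d) (mu : probability X R) (a : G -> X -> X)
    d' (Y : measurableType d') (nu : probability Y R) (b : G -> Y -> Y)
    (phi : X -> Y) : Prop :=
  [/\ measurable_fun setT phi,
      forall B, measurable B -> mu (phi @^-1` B) = nu B &
      forall g, {ae mu, forall x, phi (a g x) = b g (phi x)}].

Definition completely_positive_rokhlin_entropy (G : groupType) (R : realType)
    d (X : measurableType d) (mu : probability X R) (a : G -> X -> X) : Prop :=
  ergodic mu a /\
  forall d' (Y : measurableType d') (nu : probability Y R) (b : G -> Y -> Y)
      (phi : X -> Y),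
    standard_borel R Y -> is_pmp_action nu b ->
    is_factor_map mu a nu b phi ->
    ~ (exists y, nu [set y] = 1%E) ->
    (0 < rokhlin_entropy nu b)%E.

Definition coordinate_sets (G : Type) d (L : measurableType d) :
    set (set (G -> L)) :=
  [set A | exists (g : G) (B : set L),
     measurable B /\ A = [set x : G -> L | B (x g)]].

Definition power_space (G : Type) d (L : measurableType d) :=
  g_sigma_algebraType (@coordinate_sets G d L).

(* The library has no infinite product of measures. The measure [lambda^G] is
   the unique probability measure on [L^G] with these values on cylinders. *)
Definition is_power_measure (G : groupType) (R : realType) d
    (L : measurableType d) (lambda : probability L R)
    (mu : probability (power_space G L) R) : Prop :=
  forall (F : seq G) (B : G -> set L), uniq F ->
    (forall g, measurable (B g)) ->
    mu [set x : G -> L | forall g, g \in F -> B g (x g)]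
      = (\prod_(g <- F) lambda (B g))%E.

Definition bernoulli_shift (G : groupType) d (L : measurableType d)
    (g : G) (x : power_space G L) : power_space G L :=
  fun h : G => x (g^-1 * h)%g.

(* Main.v *)
Require Import Defs.
From HB Require Import structures.
From mathcomp Require Import all_boot all_order all_algebra.
From mathcomp Require Import all_classical all_reals all_analysis.
From mathcomp Require Import ring lra.

(* Suppose a nontrivial factor Y of L^G had zero Rokhlin entropy, and let B be a
   nontrivial event of Y, viewed in L^G. As B is not independent of itself, the
   chain rule gives a finite V, not containing 1, such that the coordinate x(1) is
   not independent of an event E0 depending on Y and on the coordinates in V.
   Since Y is generated by partitions of arbitrarily small entropy, E0 can be read,
   up to a small error, from cheap labels attached to the points, and all of
   this transfers by approximation to a Bernoulli shift with base A * bool,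
   uniformly distributed, where A is a large finite cyclic group.
   The boolean coordinate is a mark. Let E be the event that E0 holds, that 1 is
   marked and that V is unmarked; translate the symbol x(1) by a fixed j of A when
   E holds. The labels, the recoded symbols and the marks still generate: unmarked
   symbols are unchanged, so that E, and with it the original symbol, can be
   recovered. For a suitable j the recoded symbol is not uniformly distributed, by
   an amount not depending on the cost of the labels, so that this generating
   partition has entropy below that of A * bool, contrary to the assumption. *)

Set Implicit Arguments.
Unset Strict Implicit.
Unset Printing Implicit Defensive.

Import Order.TTheory GRing.Theory Num.Theory.
Import numFieldNormedType.Exports.

Local Open Scope classical_set_scope.
Local Open Scope ring_scope.

(** The entropy hypothesis is applied only to uniform finite bases, whatever the base of the given
    shift. There the entropy is [ln #|K|], the largest possible for that alphabet, so every bias of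
    the recoded symbol shows as a loss; a base of infinite entropy would leave nothing to compare
    with. The group structure of the alphabet makes the recoding reversible and lets an average over
    translations produce a good [j]. The marks break a circle: undoing the recoding at 1 requires
    the original symbols on [V], which might themselves have been recoded. The order of the choices
    is essential. The window [V] and the dependence [e], hence the gain [s], are fixed before the
    partition of small entropy is taken, so that the cost of the labels can be made small against
    [s ^+ 2]. The transfer keeps finitely many statistics of local events, as strict inequalities,
    and one exact fact: the event is a function of labels and symbols. That fact makes the decoding
    exact in the finite model, although the factor [Y] itself does not survive there. *)

(** * Real-valued probabilities *)

Definition pr d (X : measurableType d) (R : realType) (P : probability X R)
  (A : set X) : R := fine (P A).

Section RealProbability.
Context d (X : measurableType d) (R : realType) (P : probability X R).
Implicit Types A B C : set X.
Local Notation pr := (pr P).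

Lemma prE A : measurable A -> P A = (pr A)%:E.
Proof. by move=> mA; rewrite /pr fineK// fin_num_measure. Qed.

Lemma pr_ge0 A : 0 <= pr A.
Proof. by rewrite fine_ge0// measure_ge0. Qed.

Lemma pr_setT : pr setT = 1.
Proof. by rewrite /pr probability_setT. Qed.

Lemma pr_set0 : pr set0 = 0.
Proof. by rewrite /pr measure0. Qed.

Lemma pr_le A B : measurable A -> measurable B -> A `<=` B -> pr A <= pr B.
Proof.
by move=> mA mB AB; rewrite -lee_fin -!prE//; apply: le_measure; rewrite ?inE.
Qed.

Lemma pr_le1 A : measurable A -> pr A <= 1.
Proof. by move=> mA; rewrite -pr_setT pr_le. Qed.

Lemma prU A B : measurable A -> measurable B -> A `&` B = set0 ->
  pr (A `|` B) = pr A + pr B.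
Proof.
move=> mA mB AB; have : P (A `|` B) = (P A + P B)%E by exact: measureU.
by rewrite !prE//; [case|exact: measurableU].
Qed.

Lemma pr_split A B : measurable A -> measurable B ->
  pr A = pr (A `&` B) + pr (A `\` B).
Proof.
move=> mA mB; rewrite -prU; first by rewrite setUIDK.
- exact: measurableI.
- exact: measurableD.
- by rewrite setDE setIACA setICr setI0.
Qed.

Lemma prC A : measurable A -> pr (~` A) = 1 - pr A.
Proof.
by move=> mA; rewrite -pr_setT (pr_split measurableT mA) setTI setTD addrC addKr.
Qed.

Lemma pr_leU A B : measurable A -> measurable B -> pr (A `|` B) <= pr A + pr B.
Proof.
move=> mA mB; rewrite (_ : A `|` B = A `|` (B `\` A)); last first.
  apply/seteqP; split=> x /=; last by tauto.
  by have [] := pselect (A x); tauto.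
rewrite prU//.
- by rewrite lerD2l pr_le//; exact: measurableD.
- exact: measurableD.
- by rewrite setDE setICA setICr setI0.
Qed.

Lemma measurableY A B : measurable A -> measurable B -> measurable (A `+` B).
Proof. by move=> mA mB; apply: measurableU; exact: measurableD. Qed.

Lemma pr_dist A B : measurable A -> measurable B ->
  `|pr A - pr B| <= pr (A `+` B).
Proof.
move=> mA mB; rewrite (pr_split mA mB) (pr_split mB mA) setIC.
rewrite prU; first last.
- by apply/seteqP; split=> x /=; tauto.
- exact: measurableD.
- exact: measurableD.
have := pr_ge0 (A `\` B); have := pr_ge0 (B `\` A).
by move=> ? ?; rewrite ler_norml; apply/andP; split; lra.
Qed.

Lemma measurable_exists (I : eqType) (s : seq I) (F : I -> set X) :
  (forall i, i \in s -> measurable (F i)) ->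
  measurable [set x | exists2 i, i \in s & F i x].
Proof.
move=> mF; rewrite (_ : mkset _ = \bigcup_(i in [set` s]) F i).
  by apply: fin_bigcup_measurable => //; exact: finite_seq.
by apply/seteqP; split=> x [i]; exists i.
Qed.

Lemma pr_exists_le (I : eqType) (s : seq I) (F : I -> set X) :
  (forall i, i \in s -> measurable (F i)) ->
  pr [set x | exists2 i, i \in s & F i x] <= \sum_(i <- s) pr (F i).
Proof.
elim: s => [|i s IH] mF.
  rewrite big_nil (_ : mkset _ = set0) ?pr_set0//.
  by apply/seteqP; split=> x // -[].
rewrite big_cons (_ : mkset _ = F i `|` [set x | exists2 j, j \in s & F j x]).
  apply: le_trans (pr_leU _ _) _.
  - by apply: mF; rewrite mem_head.
  - by apply: measurable_exists => j js; apply: mF; rewrite in_cons js orbT.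
  - by rewrite lerD2l IH// => j js; apply: mF; rewrite in_cons js orbT.
apply/seteqP; split=> x.
  move=> [j]; rewrite in_cons => /predU1P[->|js] Fx; first by left.
  by right; exists j.
by case=> [Fx|[j js Fx]]; [exists i|exists j] => //; rewrite in_cons ?eqxx ?js ?orbT.
Qed.

Lemma measurable_fibers (U : finType) (F : X -> U) (S : set U) :
  (forall u, measurable (F @^-1` [set u])) -> measurable (F @^-1` S).
Proof.
move=> mF.
rewrite (_ : F @^-1` S = \bigcup_(u in S) F @^-1` [set u]).
  by apply: fin_bigcup_measurable => //; exact: finite_finset.
by apply/seteqP; split=> [x Sx|x [u Su /= xu]] /=; [exists (F x)|rewrite xu].
Qed.

Lemma pr_sum_fibers (U : finType) (F : X -> U) A :
  (forall u, measurable (F @^-1` [set u])) -> measurable A ->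
  pr A = \sum_u pr (A `&` F @^-1` [set u]).
Proof.
move=> mF mA.
suff key (s : seq U) : uniq s ->
    pr (A `&` [set x | F x \in s]) = \sum_(u <- s) pr (A `&` F @^-1` [set u]).
  rewrite -[in RHS]key ?index_enum_uniq//; congr (pr _).
  by apply/seteqP; split=> [x Ax|x []//]; split => //=; rewrite mem_index_enum.
elim: s => [_|u s IH /= /andP[us suniq]].
  by rewrite big_nil (_ : _ `&` _ = set0) ?pr_set0//; apply/seteqP; split=> x // -[].
rewrite big_cons -IH// -prU.
- congr (pr _); apply/seteqP; split=> x.
    move=> [Ax] /=; rewrite in_cons => /predU1P[xu|xs]; [left|right]; by split.
  by case=> -[Ax /= xu]; split => //=; rewrite in_cons xu ?eqxx ?orbT.
- by apply: measurableI => //; exact: mF.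
- by apply: measurableI => //; exact: (measurable_fibers (fun v => v \in s)).
- apply/seteqP; split=> x // -[[_ /= xu] [_ /=]]; rewrite xu => h.
  by rewrite h in us.
Qed.

End RealProbability.

(** * Finite algebras of events and approximation in measure *)

(** Membership in the finite Boolean algebra generated by [s], expressed through points so that no
    normal form of Boolean combinations is needed. *)
Definition determined (X : Type) (s : seq (set X)) (A : set X) : Prop :=
  forall x y, (forall B, B \in s -> B x <-> B y) -> A x -> A y.

Lemma determined_sub (X : Type) (s s' : seq (set X)) (A : set X) :
  {subset s <= s'} -> determined s A -> determined s' A.
Proof. by move=> ss' sA x y h; apply: sA => B /ss'; exact: h. Qed.

Lemma determinedC (X : Type) (s : seq (set X)) (A : set X) :
  determined s A -> determined s (~` A).
Proof.
move=> sA x y h nAx Ay; apply: nAx; apply: sA Ay => B Bs.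
by apply: iff_sym; exact: h.
Qed.

Lemma determinedU (X : Type) (s : seq (set X)) (A B : set X) :
  determined s A -> determined s B -> determined s (A `|` B).
Proof.
by move=> sA sB x y h [Ax|Bx]; [left; exact: sA Ax|right; exact: sB Bx].
Qed.

Lemma determined_measurable d (X : measurableType d) (s : seq (set X))
    (A : set X) :
  (forall B, B \in s -> measurable B) -> determined s A -> measurable A.
Proof.
elim: s A => [|B s IH] A ms sA.
  have [[x Ax]|nA] := pselect (exists x, A x).
    rewrite (_ : A = setT); first exact: measurableT.
    by apply/seteqP; split=> y // _; apply: sA Ax.
  rewrite (_ : A = set0); first exact: measurable0.
  by apply/seteqP; split=> y // Ay; case: nA; exists y.
have mB : measurable B by apply: ms; rewrite mem_head.
have {}ms C : C \in s -> measurable C.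
  by move=> Cs; apply: ms; rewrite in_cons Cs orbT.
pose tr (E : set X) := [set x | exists y, [/\ A y, E y &
  forall C, C \in s -> C x <-> C y]].
have mtr E : measurable (tr E).
  apply: IH => // x y h [z [Az Ez hz]]; exists z; split=> // C Cs.
  by rewrite -(hz C Cs); apply: iff_sym; exact: h.
rewrite (_ : A = (B `&` tr B) `|` (tr (~` B) `\` B)).
  by apply: measurableU; [exact: measurableI|exact: measurableD].
apply/seteqP; split=> x.
  by move=> Ax; have [Bx|nBx] := pselect (B x); [left|right]; split=> //; exists x.
case=> -[].
  move=> Bx [y [Ay By hy]]; apply: sA Ay => C; rewrite in_cons => /predU1P[->//|Cs].
  by apply: iff_sym; exact: hy.
move=> [y [Ay nBy hy]] nBx; apply: sA Ay => C; rewrite in_cons => /predU1P[->|Cs].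
  by split.
by apply: iff_sym; exact: hy.
Qed.

Lemma determined_sigma_algebra (X : pointedType) (S : set (set X))
    (s : seq (set X)) (A : set X) :
  sigma_algebra setT S -> (forall B, B \in s -> S B) -> determined s A -> S A.
Proof.
move=> sS sB sA; rewrite -(measurable_g_measurableTypeE sS).
apply: (@determined_measurable _ (g_sigma_algebraType S) s) => // B /sB.
by rewrite (measurable_g_measurableTypeE sS).
Qed.

Definition approximable d (X : measurableType d) (R : realType)
    (P : probability X R) (G : set (set X)) (A : set X) : Prop :=
  measurable A /\ forall e, 0 < e -> exists s A',
    [/\ forall B, B \in s -> G B, determined s A' & pr P (A `+` A') < e].

Section Approximation.
Context d (X : measurableType d) (R : realType) (P : probability X R).
Variable G : set (set X).
Hypothesis mG : G `<=` measurable.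
Local Notation pr := (pr P).
Local Notation approximable := (approximable P G).

Lemma approximableU A B : approximable A -> approximable B ->
  approximable (A `|` B).
Proof.
move=> [mA aA] [mB aB]; split=> [|e e0]; first exact: measurableU.
have e20 : 0 < e / 2 by lra.
have [s [A' [sG sA' eA]]] := aA _ e20.
have [t [B' [tG tB' eB]]] := aB _ e20.
have mA' : measurable A' by apply: determined_measurable sA' => C /sG /mG.
have mB' : measurable B' by apply: determined_measurable tB' => C /tG /mG.
exists (s ++ t), (A' `|` B'); split.
- by move=> C; rewrite mem_cat => /orP[/sG|/tG].
- apply: determinedU; [apply: determined_sub sA'|apply: determined_sub tB'].
    by move=> C Cs; rewrite mem_cat Cs.
  by move=> C Cs; rewrite mem_cat Cs orbT.
have mAA' := measurableY mA mA'; have mBB' := measurableY mB mB'.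
apply: (@le_lt_trans _ _ (pr ((A `+` A') `|` (B `+` B')))).
  apply: pr_le; [by apply: measurableY; exact: measurableU|exact: measurableU|].
  move=> x /=; tauto.
apply: le_lt_trans (pr_leU P mAA' mBB') _; lra.
Qed.

(** Only countable unions need an argument: continuity from below replaces the union by a finite one
    at cost [e / 2], and the other half pays for approximating that. *)
Lemma approximable_sigma : sigma_algebra setT approximable.
Proof.
have a0 : approximable set0.
  split=> [|e e0]; first exact: measurable0.
  by exists [::], set0; split=> //; rewrite setYK pr_set0.
split=> //.
- move=> A [mA aA]; rewrite setTD; split=> [|e e0]; first exact: measurableC.
  have [s [A' [sG sA' eA]]] := aA _ e0.
  exists s, (~` A'); split=> //; first exact: determinedC.
  rewrite (_ : _ `+` _ = A `+` A')//; apply/seteqP; split=> x /=.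
    by case=> -[] ? /contrapT; [right|left].
  by case=> -[] ? ?; [right|left]; split=> // /(_ _).
move=> A aA.
have mA k : measurable (A k) by case: (aA k).
have mU : measurable (\bigcup_k A k) by exact: bigcup_measurable.
split=> // e e0.
pose F n := \big[setU/set0]_(k < n) A k.
have aF n : approximable (F n).
  elim: n => [|n IH]; first by rewrite /F big_ord0.
  by rewrite /F big_ord_recr /=; apply: approximableU.
have FU : \bigcup_n F n = \bigcup_k A k.
  apply/seteqP; split=> x [n _]; rewrite /F.
    by rewrite -bigcup_mkord => -[k _ Ax]; exists k.
  by move=> Ax; exists n.+1 => //; rewrite -bigcup_mkord; exists n => /=.
have mF n : measurable (F n) by case: (aF n).
have ndF : nondecreasing_seq F.
  move=> m n mn; apply/subsetPset => x; rewrite /F -!bigcup_mkord => -[k /= km Ax].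
  by exists k => //=; apply: leq_trans km mn.
have cF : pr (F n) @[n --> \oo] --> pr (\bigcup_k A k).
  apply: fine_cvg; rewrite -prE// -FU; apply: nondecreasing_cvg_mu => //.
  by rewrite FU.
have e20 : 0 < e / 2 by lra.
have [n _ /(_ n (leqnn n)) /= hn] := (cvgrPdist_lt _ _).1 cF _ e20.
have [s [A' [sG sA' eA]]] := (aF n).2 _ e20.
have mA' : measurable A' by apply: determined_measurable sA' => C /sG /mG.
exists s, A'; split=> //.
have FsubU : F n `<=` \bigcup_k A k by rewrite -FU; exact: bigcup_sup.
have dF : pr (\bigcup_k A k `\` F n) < e / 2.
  apply: le_lt_trans hn; rewrite (pr_split P mU (mF n)) (setIidr FsubU).
  by rewrite addrAC subrr add0r ler_norm.
apply: (@le_lt_trans _ _ (pr ((\bigcup_k A k `\` F n) `|` (F n `+` A')))).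
  apply: pr_le; [exact: measurableY|apply: measurableU|].
  - exact: measurableD.
  - exact: measurableY.
  - move=> x /= [[Ux nA']|[A'x nUx]].
      by have [Fx|] := pselect (F n x); [right; left|left].
    by right; right; split=> // /FsubU.
apply: le_lt_trans (pr_leU P _ _) _; [exact: measurableD|exact: measurableY|].
lra.
Qed.

Lemma approximable_gen A : G A -> approximable A.
Proof.
move=> GA; split=> [|e e0]; first exact: mG.
exists [:: A], A; split; first by move=> B; rewrite inE => /eqP ->.
- by move=> x y /(_ A); rewrite inE eqxx => /(_ isT)[].
- by rewrite setYK pr_set0.
Qed.

Lemma approximable_null A : measurable A -> P A = 0%E -> approximable A.
Proof.
move=> mA A0; split=> // e e0; exists [::], set0; split=> //.
by rewrite setY0 /pr A0.
Qed.

End Approximation.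

(** * Power spaces and local events *)

Definition rect (G : eqType) (L : Type) (W : seq G) (B : G -> set L) :
    set (G -> L) :=
  [set x | forall g, g \in W -> B g (x g)].

Definition local (G : eqType) (T : Type) (W : seq G) (A : set (G -> T)) : Prop :=
  forall z z', (forall w, w \in W -> z w = z' w) -> A z -> A z'.

Lemma local_sub (G : eqType) (T : Type) (W W' : seq G) (A : set (G -> T)) :
  {subset W <= W'} -> local W A -> local W' A.
Proof. by move=> WW' lA z z' h; apply: lA => w /WW'; exact: h. Qed.

Section Window.
Variables (G : eqType) (L : Type) (T : finType) (f : L -> T) (t0 : T) (W : seq G).

Definition window_values (x : G -> L) : {ffun 'I_(size W) -> T} :=
  [ffun i => f (x (tnth (in_tuple W) i))].

(** Outside the window the value is the arbitrary [t0]; a [local] event does not see it. *)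
Definition extend_values (u : {ffun 'I_(size W) -> T}) (g : G) : T :=
  if insub (index g W) is Some i then u i else t0.

Lemma window_valuesP (x : G -> L) (u : {ffun 'I_(size W) -> T}) : uniq W ->
  window_values x = u <-> forall g, g \in W -> f (x g) = extend_values u g.
Proof.
move=> Wuniq; split.
  move=> <- g gW; rewrite /extend_values.
  case: insubP => [i _ iE|]; last by rewrite index_mem gW.
  by rewrite ffunE (tnth_nth g) /= iE nth_index.
move=> h; apply/ffunP => i; rewrite ffunE h ?mem_tnth// /extend_values.
have iE : index (tnth (in_tuple W) i) W = i.
  by rewrite (tnth_nth (tnth (in_tuple W) i)) index_uniq.
case: insubP => [j _ jE|]; last by rewrite iE ltn_ord.
by congr (u _); apply: val_inj; rewrite /= jE iE.
Qed.

Lemma local_valuesE (A : set (G -> T)) : uniq W -> local W A ->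
  [set x : G -> L | A (f \o x)] =
    window_values @^-1` [set u | A (extend_values u)].
Proof.
move=> Wuniq lA; apply/seteqP.
have h x := (window_valuesP x (window_values x) Wuniq).1 erefl.
by split=> x /=; apply: lA => w wW; rewrite -h.
Qed.

End Window.

Section PowerSpace.
Context (G : groupType) d (L : measurableType d).
Local Notation X := (power_space G L).

Lemma measurable_coordinate (g : G) (B : set L) : measurable B ->
  measurable ([set x | B (x g)] : set X).
Proof. by move=> mB; apply: sub_gen_smallest; exists g, B. Qed.

Lemma measurable_rect (W : seq G) (B : G -> set L) :
  (forall g, measurable (B g)) -> measurable (rect W B : set X).
Proof.
move=> mB; elim: W => [|g W IH].
  rewrite (_ : rect _ _ = setT); first exact: measurableT.
  by apply/seteqP; split=> x // _ g.
rewrite (_ : rect _ _ = [set x | B g (x g)] `&` rect W B).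
  by apply: measurableI => //; exact: measurable_coordinate.
apply/seteqP; split=> x.
  move=> h; split; first by apply: h; rewrite mem_head.
  by move=> k kW; apply: h; rewrite in_cons kW orbT.
by move=> [hg hW] k; rewrite in_cons => /predU1P[->|/hW].
Qed.

Lemma measurable_window_values (T : finType) (f : L -> T) (W : seq G)
    (u : {ffun 'I_(size W) -> T}) :
  (forall t, measurable (f @^-1` [set t])) ->
  measurable (window_values f W @^-1` [set u] : set X).
Proof.
move=> mf; rewrite (_ : _ @^-1` _ =
    \bigcap_(i in [set: 'I_(size W)]) [set x | f (x (tnth (in_tuple W) i)) = u i]).
  apply: fin_bigcap_measurable; first exact: finite_finset.
  by move=> i _; exact: (@measurable_coordinate _ (f @^-1` [set u i])).
apply/seteqP; split=> x.
  by move=> /= <- i _ /=; rewrite ffunE.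
by move=> h; apply/ffunP => i; rewrite ffunE; exact: h.
Qed.

Lemma measurable_local (T : finType) (f : L -> T) (W : seq G) (A : set (G -> T)) :
  (forall t, measurable (f @^-1` [set t])) -> local W A ->
  measurable ([set x : G -> L | A (f \o x)] : set X).
Proof.
move=> mf lA; have {}lA : local (undup W) A.
  by apply: local_sub lA => g; rewrite mem_undup.
rewrite (local_valuesE f (f point) (undup_uniq W) lA).
by apply: measurable_fibers => u; exact: measurable_window_values.
Qed.

Lemma bernoulli_shiftE (g : G) (x : X) (h : G) :
  bernoulli_shift g x h = x (g^-1 * h)%g.
Proof. by []. Qed.

Lemma bernoulli_shiftM (g h : G) (x : X) :
  bernoulli_shift (g * h)%g x = bernoulli_shift g (bernoulli_shift h x).
Proof.
by apply/funext => k; rewrite !bernoulli_shiftE invgM mulgA.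
Qed.

Lemma bernoulli_shift1 (x : X) : bernoulli_shift 1%g x = x.
Proof. by apply/funext => k; rewrite bernoulli_shiftE invg1 mul1g. Qed.

Lemma measurable_bernoulli_shift (g : G) :
  measurable_fun setT (@bernoulli_shift G d L g).
Proof.
apply: (@measurability _ _ X X setT (@bernoulli_shift G d L g) (@coordinate_sets G d L)) => //.
move=> _ [_ [h [B [mB ->]]] <-]; rewrite setTI.
exact: (@measurable_coordinate (g^-1 * h)%g).
Qed.

Lemma power_measure_unique (R : realType) (m1 m2 : {measure set X -> \bar R}) :
  (m1 setT < +oo)%E ->
  (forall W B, uniq W -> (forall g, measurable (B g)) ->
    m1 (rect W B) = m2 (rect W B)) ->
  forall A, measurable A -> m1 A = m2 A.
Proof.
move=> fin eqr.
pose rects := [set A : set X | exists W B, [/\ uniq W,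
  forall g, measurable (B g) & A = rect W B]].
have rT : rects setT.
  by exists [::], (fun=> setT); split=> //; apply/seteqP; split.
apply: (measure_unique rects (fun=> setT)) => //.
- apply/seteqP; split.
    apply: smallest_sub; first exact: smallest_sigma_algebra.
    move=> _ [g [B [mB ->]]]; apply: sub_gen_smallest.
    exists [:: g], (fun=> B); split=> //; apply/seteqP; split=> x.
      by move=> Bx h; rewrite inE => /eqP ->.
    by apply; rewrite mem_head.
  apply: smallest_sub.
    by rewrite -[X in sigma_algebra _ X]/(@measurable _ X); exact: sigma_algebra_measurable.
  by move=> _ [W [B [_ mB ->]]]; exact: measurable_rect.
- move=> _ _ [W [B [_ mB ->]]] [W' [B' [_ mB' ->]]].
  (* Each rectangle imposes [setT] outside its own window, so an intersection of rectangles is a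
     rectangle over the merged window; thus rectangles form a pi-system. *)
  pose C g := (if g \in W then B g else setT) `&` (if g \in W' then B' g else setT).
  exists (undup (W ++ W')), C; split; first exact: undup_uniq.
    by move=> g; rewrite /C; apply: measurableI; case: ifP.
  apply/seteqP; split=> x.
    move=> [h h'] g _; split.
      by case: ifP => // gW; exact: h.
    by case: ifP => // gW; exact: h'.
  move=> h; split=> g gW.
    by have := h g; rewrite mem_undup mem_cat /C gW => /(_ isT)[].
  by have := h g; rewrite mem_undup mem_cat /C gW orbT => /(_ isT)[].
- by rewrite bigcup_const.
- by move=> _ [W [B [uW mB ->]]]; exact: eqr.
Qed.

End PowerSpace.

Section PowerMeasure.
Context (G : groupType) (R : realType) d (L : measurableType d).
Variables (lambda : probability L R) (mu : probability (power_space G L) R).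
Hypothesis mulambda : is_power_measure lambda mu.

Lemma pr_rect (W : seq G) (B : G -> set L) : uniq W ->
  (forall g, measurable (B g)) ->
  pr mu (rect W B) = \prod_(g <- W) pr lambda (B g).
Proof.
move=> uW mB; rewrite /pr [in LHS]/rect mulambda//.
suff -> : (\prod_(g <- W) lambda (B g))%E = (\prod_(g <- W) pr lambda (B g))%:E by [].
rewrite (big_morph EFin (@EFinM R) erefl).
by apply: eq_bigr => g _; rewrite prE.
Qed.

Lemma pr_bernoulli_shift (g : G) (A : set (power_space G L)) : measurable A ->
  mu (bernoulli_shift g @^-1` A) = mu A.
Proof.
move=> mA; have mg := @measurable_bernoulli_shift G d L g.
(* The image of [mu] under the shift takes the same values on rectangles, as these only see the law
   of one coordinate, the same for all; uniqueness concludes. *)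
pose m2 : {measure set _ -> \bar R} := distribution mu (mfun_Sub (mem_set mg)).
apply/esym; apply: (@power_measure_unique _ _ _ _ mu m2) => //.
  by apply: (@le_lt_trans _ _ 1%E); [exact: probability_le1|exact: ltry].
move=> W B uW mB; apply/esym; rewrite /m2 /= /distribution /pushforward /=.
have mrB := measurable_rect W mB.
rewrite (_ : _ @^-1` _ = rect [seq (g^-1 * h)%g | h <- W] (fun h => B (g * h)%g)).
  rewrite !prE//; last exact: measurable_rect.
  rewrite !pr_rect//.
    by rewrite big_map; congr (_%:E); apply: eq_bigr => h _; rewrite mulVKg.
  by rewrite map_inj_uniq//; exact: mulgI.
apply/seteqP; split=> x /=.
  by move=> h _ /mapP[k kW ->]; rewrite mulVKg; exact: h.
move=> h k kW; have := h _ (map_f (fun h => (g^-1 * h)%g) kW).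
by rewrite mulVKg.
Qed.

(** Splitting by the letters in the window yields a polynomial in one-letter probabilities. The
    limit to finite bases and the factor 1/2 for each prescribed mark are both read off from it. *)
Lemma pr_local_rect (T : finType) (f : L -> T) (t0 : T) (W : seq G)
    (A : set (G -> T)) (B : G -> set L) :
  uniq W -> local W A -> (forall t, measurable (f @^-1` [set t])) ->
  (forall g, measurable (B g)) ->
  pr mu ([set x : G -> L | A (f \o x)] `&` rect W B) =
    \sum_(u : {ffun 'I_(size W) -> T}) if `[< A (extend_values t0 u) >] then
      \prod_(g <- W) pr lambda (f @^-1` [set extend_values t0 u g] `&` B g) else 0.
Proof.
move=> uW lA mf mB.
have mA := measurable_local mf lA.
have mR := measurable_rect W mB.
rewrite (pr_sum_fibers mu (F := window_values f W)); first last.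
- exact: measurableI.
- by move=> u; exact: measurable_window_values.
apply: eq_bigr => u _; case: asboolP => Au.
  rewrite -pr_rect//; last by move=> g; exact: measurableI.
  congr (pr mu _); apply/seteqP; split=> x.
    move=> [[_ Rx]] /= /(window_valuesP _ t0 _ _ uW) ux g gW; split; last exact: Rx.
    by rewrite /= ux.
  move=> h; split; first split.
  - by apply: lA Au => g /h[].
  - by move=> g /h[].
  - by apply/(window_valuesP _ t0 _ _ uW) => g /h[].
rewrite (_ : _ `&` _ = set0) ?pr_set0//; apply/seteqP; split=> x // -[[/= Ax _]].
move=> /= /(window_valuesP _ t0 _ _ uW) ux; apply: Au; apply: lA Ax => g gW /=.
by rewrite ux.
Qed.

Lemma pr_local (T : finType) (f : L -> T) (t0 : T) (W : seq G) (A : set (G -> T)) :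
  uniq W -> local W A -> (forall t, measurable (f @^-1` [set t])) ->
  pr mu [set x : G -> L | A (f \o x)] =
    \sum_(u : {ffun 'I_(size W) -> T}) if `[< A (extend_values t0 u) >] then
      \prod_(g <- W) pr lambda (f @^-1` [set extend_values t0 u g]) else 0.
Proof.
move=> uW lA mf.
have := pr_local_rect t0 uW lA mf (fun=> measurableT).
rewrite (_ : rect _ _ = setT) ?setIT; last by apply/seteqP; split.
move=> ->; apply: eq_bigr => u _; case: ifP => // _.
by apply: eq_bigr => g _; rewrite setIT.
Qed.

Lemma pr_rect_indep (T : finType) (f : L -> T) (W W' : seq G)
    (A : set (G -> T)) (B : G -> set L) :
  uniq W -> uniq W' -> (forall g, g \in W -> g \notin W') -> local W A ->
  (forall t, measurable (f @^-1` [set t])) -> (forall g, measurable (B g)) ->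
  pr mu ([set x : G -> L | A (f \o x)] `&` rect W' B) =
    pr mu [set x : G -> L | A (f \o x)] * pr mu (rect W' B).
Proof.
move=> uW uW' WW' lA mf mB.
have mA := measurable_local mf lA.
have mR := measurable_rect W' mB.
have mF u := @measurable_window_values G _ L _ f W u mf.
rewrite (pr_sum_fibers mu mF (measurableI _ _ mA mR)).
rewrite (pr_sum_fibers mu mF mA) mulr_suml; apply: eq_bigr => u _.
rewrite (local_valuesE f (f point) uW lA).
have [Au|nAu] := pselect (A (extend_values (f point) u)); last first.
  rewrite (_ : _ `&` _ `&` _ = set0); last first.
    by apply/seteqP; split=> x // -[[/= Ax _]] ux; apply: nAu; rewrite -ux.
  rewrite (_ : _ `&` _ = set0) ?pr_set0 ?mul0r//.
  by apply/seteqP; split=> x // -[/= Ax] ux; apply: nAu; rewrite -ux.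
pose C g := f @^-1` [set extend_values (f point) u g].
have mC g : measurable (C g) by exact: mf.
rewrite [X in _ = pr mu X * _](_ : _ = rect W C); last first.
  apply/seteqP; split=> x.
    by move=> [_] /= /(window_valuesP _ (f point) _ _ uW) h g /h.
  by move=> h; have /= h' := (window_valuesP f (f point) x u uW).2 h; split=> //=; rewrite h'.
(* As the windows are disjoint, prescribing the letters on [W] and [B] on [W'] is a single rectangle
   over [W ++ W'], whose product formula factors. *)
pose C' g := if g \in W then C g else B g.
rewrite [X in pr mu X = _](_ : _ = rect (W ++ W') C'); last first.
  apply/seteqP; split=> x.
    move=> [[_ Rx]] /= /(window_valuesP _ (f point) _ _ uW) h g.
    rewrite mem_cat /C'; case: ifPn => [/h//|_ /= gW']; exact: Rx.
  move=> h; have h' : rect W C x.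
    by move=> g gW; have := h g; rewrite mem_cat /C' gW; exact.
  have /= h2 := (window_valuesP f (f point) x u uW).2 h'; split=> //=; split; first by rewrite h2.
  move=> g gW'; have := h g; rewrite mem_cat gW' orbT /C' => /(_ isT).
  by case: ifPn => // /WW'; rewrite gW'.
rewrite !pr_rect//; first last.
- by move=> g; rewrite /C'; case: ifP.
- rewrite cat_uniq uW uW' andbT /=; apply/hasPn => g gW'.
  by apply/negP => /WW'; rewrite gW'.
rewrite big_cat /= ; congr (_ * _); rewrite big_seq [RHS]big_seq; apply: eq_bigr => g gW.
  by rewrite /C' gW.
by rewrite /C'; case: ifPn => // /WW'; rewrite gW.
Qed.

End PowerMeasure.

(** * Ergodicity and dependence *)

(** A finite alphabet in place of [L]: a letter records which of the sets in [Cs] contain the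
    point. *)
Definition signature (L : Type) (Cs : seq (set L)) (l : L) :
    {ffun 'I_(size Cs) -> bool} :=
  [ffun i => `[< tnth (in_tuple Cs) i l >]].

Lemma signature_eq (L : Type) (Cs : seq (set L)) (l l' : L) :
  signature Cs l = signature Cs l' -> forall C, C \in Cs -> C l <-> C l'.
Proof.
move=> ll' C CCs; have /tnthP[i ->] : C \in in_tuple Cs by [].
have /ffunP/(_ i) := ll'; rewrite !ffunE => h.
by split=> Cl; apply/asboolP; [rewrite -h|rewrite h]; apply/asboolP.
Qed.

Lemma measurable_signature d (L : measurableType d) (Cs : seq (set L)) :
  (forall C, C \in Cs -> measurable C) ->
  forall t, measurable (signature Cs @^-1` [set t]).
Proof.
move=> mCs t; apply: (determined_measurable (s := Cs)) => // l l' h <-.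
apply/ffunP => i; rewrite !ffunE; apply: asbool_equiv_eq.
by apply: iff_sym; apply: h; exact: mem_tnth.
Qed.

Lemma infinite_avoid (T : choiceType) (s : seq T) :
  infinite_set [set: T] -> exists g : T, g \notin s.
Proof.
move=> Tinf; apply: contra_notP Tinf => h.
apply: (sub_finite_set _ (finite_seq s)) => g _ /=.
by apply: contra_notT h => gs; exists g.
Qed.

Section Cylinders.
Context (G : groupType) d (L : measurableType d).
Local Notation X := (power_space G L).

(** The quantification over all larger [Cs'] and [W'] lets several events be expressed later over
    one common alphabet and window. *)
Lemma coordinate_determined_local (s : seq (set X)) (A : set X) :
  (forall B, B \in s -> @coordinate_sets G d L B) -> determined s A ->
  exists (Cs : seq (set L)) (W : seq G), (forall C, C \in Cs -> measurable C) /\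
    forall (Cs' : seq (set L)) (W' : seq G), {subset Cs <= Cs'} -> {subset W <= W'} ->
    exists A' : set (G -> {ffun 'I_(size Cs') -> bool}), local W' A' /\
      A = [set x : G -> L | A' (signature Cs' \o x)].
Proof.
move=> cs sA.
have [Cs [W [mCs hs]]] : exists (Cs : seq (set L)) (W : seq G),
    (forall C, C \in Cs -> measurable C) /\
    forall B, B \in s -> exists (g : G) (C : set L), [/\ g \in W, C \in Cs &
      B = [set x : G -> L | C (x g)]].
  elim: s cs {sA} => [|B s IH] cs; first by exists [::], [::].
  have [|Cs [W [mCs hs]]] := IH.
    by move=> C Cs; apply: cs; rewrite in_cons Cs orbT.
  have [g [C [mC BE]]] := cs B (mem_head _ _).
  exists (C :: Cs), (g :: W); split.
    by move=> D; rewrite in_cons => /predU1P[->//|/mCs].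
  move=> D; rewrite in_cons => /predU1P[->|/hs[h [E [hW ECs ->]]]].
    by exists g, C; rewrite !mem_head.
  by exists h, E; rewrite !in_cons hW ECs !orbT.
exists Cs, W; split=> // Cs' W' CsCs' WW'.
(* The patterns that agree on [W'] with the letters of some point of [A]; since [A] is determined by
   sets seen in these letters, every point with such a pattern lies in [A]. *)
exists [set z | exists x, A x /\ forall w, w \in W' -> signature Cs' (x w) = z w].
split.
  move=> z z' h [x [Ax xz]]; exists x; split=> // w wW.
  by rewrite xz// h.
apply/seteqP; split=> x /=; first by move=> Ax; exists x.
move=> [y [Ay yx]]; apply: sA Ay => B /hs[g [C [gW CCs ->]]] /=.
exact: signature_eq (yx _ (WW' _ gW)) _ (CsCs' _ CCs).
Qed.

Context (R : realType) (lambda : probability L R).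
Variable mu : probability (power_space G L) R.
Hypothesis mulambda : is_power_measure lambda mu.

Lemma coordinate_approximable (A : set X) : measurable A ->
  approximable mu (@coordinate_sets G d L) A.
Proof.
have sub : @coordinate_sets G d L `<=` (measurable : set (set X)).
  exact: sub_gen_smallest.
apply: smallest_sub; first exact: approximable_sigma.
by move=> B; exact: approximable_gen.
Qed.

Lemma pr_local_indep (T : finType) (f : L -> T) (W W' : seq G)
    (A A' : set (G -> T)) :
  uniq W -> uniq W' -> (forall g, g \in W -> g \notin W') ->
  local W A -> local W' A' -> (forall t, measurable (f @^-1` [set t])) ->
  pr mu ([set x : G -> L | A (f \o x)] `&` [set x : G -> L | A' (f \o x)]) =
    pr mu [set x : G -> L | A (f \o x)] * pr mu [set x : G -> L | A' (f \o x)].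
Proof.
move=> uW uW' WW' lA lA' mf.
have mA := measurable_local mf lA.
have mA' := measurable_local mf lA'.
have mF u := @measurable_window_values G _ L _ f W' u mf.
rewrite (pr_sum_fibers mu mF (measurableI _ _ mA mA')).
rewrite (pr_sum_fibers mu mF mA') mulr_sumr; apply: eq_bigr => u _.
rewrite (local_valuesE f (f point) uW' lA') -setIA.
have [Au|nAu] := pselect (A' (extend_values (f point) u)); last first.
  rewrite (_ : _ @^-1` _ `&` _ @^-1` _ = set0) ?setI0 ?pr_set0 ?mulr0//.
  by apply/seteqP; split=> x // -[/= Ax] ux; apply: nAu; rewrite -ux.
rewrite (_ : _ `&` window_values f W' @^-1` _ =
    rect W' (fun g => f @^-1` [set extend_values (f point) u g])).
  by apply: (pr_rect_indep mulambda uW uW' WW' lA mf) => g; exact: mf.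
apply/seteqP; split=> x.
  by move=> [_] /= /(window_valuesP _ (f point) _ _ uW') h g /h.
move=> h; have /= h' := (window_valuesP f (f point) x u uW').2 h.
by split=> //=; rewrite h'.
Qed.

Lemma pr_shift (g : G) (A : set X) : measurable A ->
  pr mu (bernoulli_shift g @^-1` A) = pr mu A.
Proof. by move=> mA; rewrite /pr (pr_bernoulli_shift mulambda). Qed.

Lemma measurable_shift (g : G) (A : set X) : measurable A ->
  measurable (bernoulli_shift g @^-1` A).
Proof.
by move=> mA; rewrite -[X in measurable X]setTI; exact: measurable_bernoulli_shift.
Qed.

(** Mixing: a local approximation [B] of the invariant [A] is independent of a distant translate of
    itself, so the probability of [A] is within any error of its own square. *)
Lemma bernoulli_ergodic : infinite_set [set: G] ->
  ergodic mu (@bernoulli_shift G d L).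
Proof.
move=> Ginf A mA Ainv.
suff pp : pr mu A = pr mu A * pr mu A.
  have [p0|p0] := eqVneq (pr mu A) 0; [left|right]; rewrite prE//; first by rewrite p0.
  by congr (_%:E); apply: (mulfI p0); rewrite mulr1 -pp.
apply/eqP; rewrite -subr_eq0 -normr_eq0; apply/eqP/le_anti; rewrite normr_ge0 andbT.
apply/ler_addgt0Pr => e e0; rewrite add0r.
(* The error is paid four times: twice in passing from [A] to [B] and its translate, twice in
   replacing the square of [pr mu A] by that of [pr mu B]. *)
have e40 : 0 < e / 4 by lra.
have [s [B [cs sB eB]]] := (coordinate_approximable mA).2 _ e40.
have [Cs [W [mCs hB]]] := coordinate_determined_local cs sB.
have {hB} [|A' [lA' BE]] := hB Cs (undup W) (fun=> id).
  by move=> g; rewrite mem_undup.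
have uW := undup_uniq W; move: uW lA'; set V := undup W => uV lA'.
have mf := measurable_signature mCs; set f := signature Cs in mf BE.
(* If [g] is no quotient [w * v^-1], the window and its translate by [g^-1] are disjoint. *)
have [g gV] := infinite_avoid [seq (w * v^-1)%g | w <- V, v <- V] Ginf.
have mB : measurable B by rewrite BE; exact: measurable_local lA'.
pose A'' : set (G -> _) := [set z | A' (fun h => z (g^-1 * h)%g)].
have lA'' : local [seq (g^-1 * h)%g | h <- V] A''.
  move=> z z' h; apply: lA' => w wV; apply: h.
  exact: (map_f (fun h => (g^-1 * h)%g)).
have BgE : bernoulli_shift g @^-1` B = [set x : G -> L | A'' (f \o x)] by rewrite BE.
have indep : pr mu (B `&` bernoulli_shift g @^-1` B) = pr mu B * pr mu B.
  rewrite -[X in _ = _ * X](pr_shift g mB) BgE BE.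
  apply: (pr_local_indep uV _ _ lA' lA'' mf).
    by rewrite map_inj_uniq//; exact: mulgI.
  move=> v vV; apply/negP => /mapP[w wV vE]; move/negP: gV; apply.
  by apply/allpairsP; exists (w, v) => /=; split=> //; rewrite vE invgM invgK mulVKg.
have mgB := measurable_shift g mB.
have dA : `|pr mu A - pr mu B| < e / 4 by apply: le_lt_trans eB; exact: pr_dist.
have dAB : `|pr mu A - pr mu (B `&` bernoulli_shift g @^-1` B)| < e / 2.
  have mBB := measurableI _ _ mB mgB.
  apply: le_lt_trans (pr_dist mu mA mBB) _.
  apply: (@le_lt_trans _ _ (pr mu ((A `+` B) `|` (bernoulli_shift g @^-1` (A `+` B))))).
    apply: pr_le; [exact: measurableY|apply: measurableU|].
    - exact: measurableY.
    - by apply: measurable_shift; exact: measurableY.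
    - have AS x : A (bernoulli_shift g x) = A x by rewrite -[in RHS](Ainv g).
      move=> x /=; rewrite AS.
      by have [] := pselect (B x); tauto.
  apply: le_lt_trans (pr_leU mu _ _) _; [exact: measurableY| |].
    by apply: measurable_shift; exact: measurableY.
  by rewrite pr_shift; [lra|exact: measurableY].
have := pr_ge0 mu A; have := pr_ge0 mu B; have := pr_le1 mu mA; have := pr_le1 mu mB.
move: dA dAB; rewrite indep; set p := pr mu A; set q := pr mu B.
rewrite !ltr_norml => /andP[? ?] /andP[? ?] ? ? ? ?.
by rewrite ler_norml; apply/andP; split; nra.
Qed.

(** Otherwise coordinates can be peeled off one at a time, which makes [P] independent of every
    rectangle, hence of every event and of itself, against [0 < pr mu P < 1]. *)
Lemma nontrivial_dependence (P : set X) : measurable P ->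
  0 < pr mu P < 1 ->
  exists g D V C, [/\ measurable D, forall h, measurable (C h), uniq V, g \notin V &
    pr mu ([set x : G -> L | D (x g)] `&` rect V C `&` P) !=
      pr lambda D * pr mu (rect V C `&` P)].
Proof.
move=> mP /andP[P0 P1]; apply: contrapT => hn.
have eqn g D V C : measurable D -> (forall h, measurable (C h)) -> uniq V ->
    g \notin V -> pr mu ([set x : G -> L | D (x g)] `&` rect V C `&` P) =
      pr lambda D * pr mu (rect V C `&` P).
  move=> mD mC uV gV; apply/eqP; apply: contra_notT hn => ne.
  by exists g, D, V, C.
have indep W B : uniq W -> (forall h, measurable (B h)) ->
    pr mu (rect W B `&` P) = pr mu (rect W B) * pr mu P.
  move=> uW mB; rewrite (pr_rect mulambda)//.
  elim: W uW => [_|g W IH /= /andP[gW uW]].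
    rewrite big_nil mul1r (_ : rect _ _ = setT) ?setTI//.
    by apply/seteqP; split.
  rewrite big_cons -mulrA -IH// -(eqn g (B g) W B)//; congr (pr mu (_ `&` P)).
  apply/seteqP; split=> x.
    move=> h; split; first by apply: h; rewrite mem_head.
    by move=> k kW; apply: h; rewrite in_cons kW orbT.
  by move=> [hg hW] k; rewrite in_cons => /predU1P[->|/hW].
(* The two finite measures compared are the restriction of [mu] to [P] and [mu] scaled by [pr mu P];
   they are evaluated at [P]. *)
have := @power_measure_unique G d L R (mrestr mu mP)
  (mscale (NngNum (pr_ge0 mu P)) mu).
have PP : pr mu P = pr mu P * pr mu P -> False.
  by move=> h; nra.
move=> /(_ _ _ P mP) h; apply: PP; apply: EFin_inj.
have {h} : mrestr mu mP P = mscale (NngNum (pr_ge0 mu P)) mu P.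
  apply: h.
    rewrite /mrestr; apply: (@le_lt_trans _ _ 1%E); last exact: ltry.
    by apply: probability_le1; exact: measurableI.
  move=> W B uW mB; have mR := measurable_rect W mB.
  transitivity ((pr mu (rect W B `&` P))%:E).
    by apply: prE; exact: measurableI.
  rewrite indep// EFinM muleC; congr (_ * _)%E.
  by apply/esym; exact: prE.
move=> h; rewrite EFinM -[RHS]/((pr mu P)%:E * (pr mu P)%:E)%E -[X in (_ * X)%E]prE//.
by rewrite -[RHS]h -prE// /mrestr setIid.
Qed.

End Cylinders.

(** * Bernoulli shifts with uniform finite base *)

(* The points of a finite type as a Borel space with all subsets measurable;
   [k0] only provides the canonical point that measurable types carry. *)
Definition finite_space (K : finType) (k0 : K) : Type := K.

HB.instance Definition _ (K : finType) (k0 : K) := Finite.on (finite_space k0).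
HB.instance Definition _ (K : finType) (k0 : K) :=
  isPointed.Build (finite_space k0) k0.
HB.instance Definition _ (K : finType) (k0 : K) :=
  @isMeasurable.Build default_measure_display (finite_space k0)
    discrete_measurable discrete_measurable0
    discrete_measurableC discrete_measurableU.

Definition discrete_metric (R : realType) (K : choiceType) : Type := K.

Section DiscreteMetric.
Variables (R : realType) (K : choiceType).
Local Notation D := (discrete_metric R K).

Let dist (x y : D) : R := ((x : K) != y)%:R.

Let distxx x : dist x x = 0. Proof. by rewrite /dist eqxx. Qed.

Let dist_eq0 x y : dist x y = 0 -> x = y.
Proof. by rewrite /dist; case: eqP => // _ /eqP; rewrite oner_eq0. Qed.

Let dist_sym x y : dist x y = dist y x.
Proof. by rewrite /dist eq_sym. Qed.

Let dist_triangle y x z : dist x z <= dist x y + dist y z.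
Proof.
rewrite /dist; have [->|xy] := eqVneq (x : K) y; first by rewrite add0r.
by case: (_ != z) => /=; rewrite ?lerDl ?ler0n ?addr_ge0.
Qed.

HB.instance Definition _ := Choice.copy D K.
HB.instance Definition _ := isMetric.Build R D distxx dist_eq0 dist_sym dist_triangle.

Lemma discrete_ball1 (x y : D) : ball x (1 : R) y -> x = y.
Proof.
rewrite ballEmdist /= => h; apply: dist_eq0; move: h.
rewrite -[mdist x y]/(dist x y) /dist.
by case: (_ != _) => //; rewrite ltxx.
Qed.

End DiscreteMetric.

Lemma finite_space_standard (R : realType) (K : finType) (k0 : K) :
  standard_borel R (finite_space k0).
Proof.
exists (discrete_metric R K), (fun k => k); split.
(* Balls of radius 1 are single points, so a Cauchy filter concentrates on one point. *)
- move=> F PF /cauchyP/(_ 1 ltr01)[x Fx]; exists x => A /nbhs_singleton Ax.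
  by apply: filterS Fx => y /discrete_ball1 <-.
- exists setT => //.
    exact: (@countableP K setT).
  by move=> O [x Ox] _; exists x.
- by exists (fun k => k).
- move=> A; split=> // _; apply: sub_gen_smallest.
  rewrite openE => x Ax; apply/nbhs_ballP; exists 1; first exact: ltr01.
  by move=> y /discrete_ball1 <-.
Qed.

(** * Base-[N] digits of a uniform real number *)

Section Digits.
Context (R : realType).
Variable N' : nat.
Local Notation N := N'.+1.

Definition digit (i : nat) (x : R) : nat := Num.truncn (N%:R ^+ i.+1 * x) %% N.

(** [digit] counts from the most significant place, so among [n] digits the last one, [m %% N], has
    index [n - 1]. *)
Fixpoint digits_in (B : nat -> pred nat) (n m : nat) : bool :=
  if n is n'.+1 then digits_in B n' (m %/ N) && B n' (m %% N)%N else true.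

Lemma truncn_divn (y : R) : 0 <= y ->
  Num.truncn y = (Num.truncn (N%:R * y) %/ N)%N.
Proof.
move=> y0; apply: Num.Theory.truncn_def.
have Ny0 : 0 <= N%:R * y by rewrite mulr_ge0.
have /andP[h1 h2] := Num.Theory.truncn_itv Ny0.
set m := Num.truncn _ in h1 h2 *.
have N0 : 0 < N%:R :> R by rewrite ltr0n.
apply/andP; split.
  rewrite -(ler_pM2l N0) (le_trans _ h1)// -natrM ler_nat mulnC.
  exact: leq_trunc_div.
rewrite -(ltr_pM2l N0) (lt_le_trans h2)// -natrM ler_nat mulnC.
by rewrite ltn_ceil.
Qed.

Lemma digits_inP (B : nat -> pred nat) (n : nat) (x : R) : 0 <= x ->
  (forall i, (i < n)%N -> B i (digit i x)) <->
  digits_in B n (Num.truncn (N%:R ^+ n * x)).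
Proof.
move=> x0; elim: n => [|n IH] //=.
rewrite {1}exprS -mulrA -truncn_divn; last by rewrite mulr_ge0// exprn_ge0.
split.
  move=> h; apply/andP; split; last exact: h.
  by apply/IH => i /ltnW; exact: h.
move=> /andP[/IH h1 h2] i; rewrite ltnS leq_eqVlt => /predU1P[->//|].
exact: h1.
Qed.

(** Writing [m = q * N + e] shows that the numbers below [N ^ n] are exactly the free choices of [n]
    digits; the independence of the digits is this count. *)
Lemma sum_digits_in (B : nat -> pred nat) (n : nat) :
  (\sum_(0 <= m < N ^ n) digits_in B n m =
   \prod_(0 <= i < n) \sum_(0 <= e < N) B i e)%N.
Proof.
elim: n => [|n IH]; first by rewrite expn0 big_nat1 big_geq.
rewrite expnS mulnC big_nat_mul big_nat_recr//= -IH big_distrl /=.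
apply: eq_bigr => q _; rewrite big_distrr /= mulSn.
rewrite [in X in \sum_(X <= _ < _) _](_ : q * N = 0 + q * N)%N// big_addn addnK.
rewrite !big_mkord; apply: eq_bigr => e _.
by rewrite addnC divnMDl// divn_small// addn0 modnMDl modn_small// mulnb.
Qed.

Lemma measurable_truncn (c : R) (S : set nat) : 0 < c ->
  measurable [set x : R | S (Num.truncn (c * x))].
Proof.
move=> c0.
rewrite (_ : mkset _ = \bigcup_(k in S) [set x : R | Num.truncn (c * x) = k]); last first.
  by apply/seteqP; split=> [x Sx|x [k Sk /= xk]] /=; [exists (Num.truncn (c * x))|rewrite xk].
apply: bigcup_measurable => k _.
have hk : measurable [set x : R | k%:R / c <= x < k.+1%:R / c].
  rewrite (_ : mkset _ = `[k%:R / c, k.+1%:R / c[%classic); first exact: measurable_itv.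
  by apply/seteqP; split=> x /=; rewrite in_itv.
have h0 : measurable [set x : R | x < 0].
  rewrite (_ : mkset _ = `]-oo, 0[%classic); first exact: measurable_itv.
  by apply/seteqP; split=> x /=; rewrite in_itv.
have E x : (k%:R / c <= x < k.+1%:R / c) = (k%:R <= c * x < k.+1%:R).
  by rewrite ler_pdivrMr// ltr_pdivlMr// mulrC.
(* Truncation sends negative reals to 0, so the fibre over 0 also contains the negative
   half-line. *)
have [k0|k0] := eqVneq k 0%N.
  rewrite (_ : mkset _ = [set x : R | k%:R / c <= x < k.+1%:R / c] `|` [set x | x < 0]).
    exact: measurableU.
  apply/seteqP; split=> x /=; rewrite E.
    move=> <-; have [cx|cx] := leP 0 (c * x); [left; exact: Num.Theory.truncn_itv|right].
    by rewrite -(pmulr_rlt0 _ c0).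
  move=> [/Num.Theory.truncn_def//|x0]; rewrite Num.Theory.truncn_floor k0.
  by rewrite leNgt pmulr_rlt0// x0.
rewrite (_ : mkset _ = [set x : R | k%:R / c <= x < k.+1%:R / c])//.
apply/seteqP; split=> x /=; rewrite E; last by move/Num.Theory.truncn_def.
move=> kE; rewrite -{1 2}kE; apply: Num.Theory.truncn_itv; rewrite leNgt; apply/negP => cx.
by move/negP: k0; apply; rewrite -kE Num.Theory.truncn_floor leNgt cx.
Qed.

Lemma measurable_digit (i : nat) (S : set nat) : measurable [set x : R | S (digit i x)].
Proof.
apply: (@measurable_truncn (N%:R ^+ i.+1) (fun m => S (m %% N)%N)).
by rewrite exprn_gt0.
Qed.

Definition unit_lebesgue : set (measurableTypeR R) -> \bar R :=
  mrestr (@lebesgue_measure R) (measurable_itv `[0, 1[).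

HB.instance Definition _ := Measure.copy unit_lebesgue
  (mrestr (@lebesgue_measure R) (measurable_itv `[0, 1[)).

Let unit_lebesgueT : unit_lebesgue setT = 1%E.
Proof.
by rewrite /unit_lebesgue /mrestr setTI lebesgue_measure_itv /= lte_fin ltr01 oppr0 adde0.
Qed.

HB.instance Definition _ :=
  Measure_isProbability.Build _ _ R unit_lebesgue unit_lebesgueT.

Lemma unit_lebesgueE (A : set (measurableTypeR R)) :
  pr unit_lebesgue A = fine (lebesgue_measure (A `&` [set` `[0, 1[])).
Proof. by []. Qed.

Lemma pr_unit_truncn (M : nat) (S : pred nat) : (0 < M)%N ->
  pr unit_lebesgue [set x : R | S (Num.truncn (M%:R * x))] =
  (\sum_(0 <= m < M) S m)%:R / M%:R.
Proof.
case: M => // M _; set c : R := M.+1%:R.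
have c0 : 0 < c by rewrite ltr0n.
have mS : measurable ([set x : R | S (Num.truncn (c * x))] : set (measurableTypeR R)).
  exact: (@measurable_truncn c (fun m => S m)).
(* Outside [[0, 1[] the truncation may leave the range of ['I_M.+1], and [inord] returns a default;
   the fibres are the expected intervals only within [[0, 1[], which carries all the mass. *)
pose F (x : measurableTypeR R) : 'I_M.+1 := inord (Num.truncn (c * x)).
have mF u : measurable (F @^-1` [set u]).
  exact: (@measurable_truncn c (fun m => inord m = u)).
rewrite (pr_sum_fibers _ mF mS) big_mkord natr_sum mulr_suml; apply: eq_bigr => u _.
have fiberE x : 0 <= x < 1 -> (F x = u) <-> (u%:R / c <= x < u.+1%:R / c).
  move=> /andP[x0 x1]; have cx0 : 0 <= c * x by rewrite mulr_ge0// ltW.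
  have tM : (Num.truncn (c * x) < M.+1)%N.
    rewrite -(ltr_nat R) (le_lt_trans (andP (Num.Theory.truncn_itv cx0)).1)//.
    by rewrite gtr_pMr.
  rewrite ler_pdivrMr// ltr_pdivlMr// mulrC; split.
    by move=> /(congr1 val); rewrite /= inordK// => <-; exact: Num.Theory.truncn_itv.
  by move=> /Num.Theory.truncn_def h; rewrite /F h inord_val.
rewrite unit_lebesgueE.
have [Su|nSu] := boolP (S u); last first.
  rewrite (_ : _ `&` _ `&` _ = set0) ?measure0 ?mul0r//.
  apply/seteqP; split=> x //= -[[Sx /= Fx]]; rewrite in_itv /= => x01.
  move/negP: nSu; apply; have := (fiberE x x01).1 Fx.
  rewrite ler_pdivrMr// ltr_pdivlMr// mulrC => /Num.Theory.truncn_def tx.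
  by move: Sx; rewrite tx.
have uc : 0 <= u%:R / c by rewrite divr_ge0// ltW.
have uc1 : u.+1%:R / c <= 1 by rewrite ler_pdivrMr// mul1r ler_nat ltn_ord.
rewrite (_ : _ `&` _ `&` _ = `[u%:R / c, u.+1%:R / c[%classic).
  rewrite lebesgue_measure_itv /= lte_fin ltr_pM2r ?invr_gt0// ltr_nat ltnSn /=.
  by rewrite -mulrBl -natrB// subSnn.
apply/seteqP; split=> x /=; rewrite !in_itv /=.
  by move=> [[_ Fx] x01]; apply/fiberE.
move=> xu; have x01 : 0 <= x < 1.
  by have /andP[h1 h2] := xu; rewrite (le_trans uc h1) (lt_le_trans h2 uc1).
split=> //; split; last exact/fiberE.
move: xu; rewrite ler_pdivrMr// ltr_pdivlMr// mulrC => /Num.Theory.truncn_def ->.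
exact: Su.
Qed.

Lemma pr_digits (B : nat -> pred nat) (n : nat) :
  pr unit_lebesgue [set x : R | forall i, (i < n)%N -> B i (digit i x)] =
  \prod_(0 <= i < n) ((\sum_(0 <= e < N) B i e)%:R / N%:R).
Proof.
rewrite prodf_div -natr_prod -sum_digits_in prodr_const_nat subn0 -natrX.
rewrite -pr_unit_truncn ?expn_gt0// !unit_lebesgueE.
congr (fine (lebesgue_measure _)).
apply/seteqP; split=> x /=; rewrite in_itv /= natrX => -[h x01]; split=> //.
  by apply/digits_inP => //; case/andP: x01.
by apply/digits_inP => //; case/andP: x01.
Qed.

End Digits.

Lemma esum_seq (R : realType) (T : choiceType) (s : seq T) (a : T -> \bar R) :
  uniq s -> (forall i, i \in s -> 0 <= a i)%E ->
  (\esum_(i in [set` s]) a i = \sum_(i <- s) a i)%E.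
Proof.
move=> us a0; rewrite (esum_fset (finite_seq s)); last first.
  by move=> i; rewrite inE; exact: a0.
by rewrite (fsbig_seq _ a us).
Qed.

Section UniformBernoulli.
Context (R : realType) (G : groupType) (K : finType) (k0 : K).
Hypothesis Gcount : countable [set: G].
Local Notation L := (finite_space k0).

Definition uniform_measure (lambda : probability L R) : Prop :=
  forall B : pred K, pr lambda (fun k => B k) = #|B|%:R / #|K|%:R.

(** The entropy hypothesis speaks of a given power measure, so one must be exhibited. Enumerating
    [G] by an injection into the naturals, the coordinate at [g] is the digit with index [idx g] of
    a Lebesgue-random real. *)
Lemma uniform_power_measure : exists (lambda : probability L R)
  (mu : probability (power_space G L) R),
  uniform_measure lambda /\ is_power_measure lambda mu.
Proof.
have [N' NE] : exists N', #|K| = N'.+1.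
  by exists #|K|.-1; rewrite prednK//; apply/card_gt0P; exists k0.
have [idx idx_inj] := countable_injP _ Gcount.
pose lab (e : nat) : L := nth k0 (enum K) e.
have count_lab (B : pred K) : (\sum_(0 <= e < N'.+1) B (lab e) = #|B|)%N.
  rewrite -NE cardT -(big_nth k0 xpredT (fun k => B k : nat)) big_enum /=.
  by rewrite -sum1_card [RHS]big_mkcond; apply: eq_bigr => k _; rewrite unfold_in; case: (B k).
pose X0 (x : measurableTypeR R) : L := lab (digit N' 0 x).
have mX0 : measurable_fun setT X0.
  by move=> _ S _; rewrite setTI; exact: (measurable_digit N' 0 (fun e => S (lab e))).
pose Phi (x : measurableTypeR R) : power_space G L := fun g => lab (digit N' (idx g) x).
have mPhi : measurable_fun setT Phi.
  apply: (@measurability _ _ _ (power_space G L) setT Phi (@coordinate_sets G _ L)) => //.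
  move=> _ [_ [g [B [_ ->]]] <-]; rewrite setTI.
  exact: (measurable_digit N' (idx g) (fun e => B (lab e))).
pose P : probability (measurableTypeR R) R := @unit_lebesgue R.
pose lambda : probability L R := distribution P (mfun_Sub (mem_set mX0)).
pose mu : probability (power_space G L) R := distribution P (mfun_Sub (mem_set mPhi)).
exists lambda, mu.
have lamE (B : pred K) : pr lambda (fun k => B k) = #|B|%:R / #|K|%:R.
  transitivity (pr P [set x | forall i, (i < 1)%N -> B (lab (digit N' i x))]).
    congr (fine (P _)); apply/seteqP; split=> x /=; last exact.
    by move=> Bx i; rewrite ltnS leqn0 => /eqP ->.
  rewrite (@pr_digits R N' (fun _ e => B (lab e)) 1) big_nat1.
  by rewrite count_lab NE.
split=> // W B uW mB.
rewrite -[mu _]/(P _) prE; last first.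
  rewrite -[X in measurable X]setTI.
  exact: (mPhi measurableT _ (measurable_rect W mB)).
rewrite (_ : (\prod_(g <- W) lambda (B g))%E = (\prod_(g <- W) pr lambda (B g))%:E); last first.
  rewrite (big_morph EFin (@EFinM R) erefl).
  by apply: eq_bigr => g _; rewrite prE.
congr (_%:E).
(* The constraint put on digit [i] by the elements of [W] with index [i]; for every other digit it
   is vacuous and contributes a factor 1. *)
pose Bi (i : nat) : pred nat := fun e => `[< forall g, g \in W -> idx g = i -> B g (lab e) >].
pose n := (\max_(g <- W) idx g).+1.
have ltn_idx g : g \in W -> (idx g < n)%N.
  by move=> gW; rewrite ltnS; exact: leq_bigmax_seq.
transitivity (pr P [set x | forall i, (i < n)%N -> Bi i (digit N' i x)]).
  congr (fine (P _)); apply/seteqP; split=> x /=.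
    by move=> h i _; apply/asboolP => g gW <-; exact: h.
  by move=> h g gW; have /asboolP := h _ (ltn_idx g gW); exact.
rewrite (@pr_digits R N' Bi n).
have idxI : injective idx by move=> g h; apply: idx_inj; rewrite inE.
have uI : uniq (map idx W) by rewrite map_inj_uniq.
rewrite (bigID (mem (map idx W))) /= mulrC big1 ?mul1r.
  rewrite -big_filter (perm_big (map idx W)); last first.
    apply: uniq_perm => //; first by rewrite filter_uniq// iota_uniq.
    move=> i; rewrite mem_filter mem_index_iota /=.
    by apply/andP/idP => [[]//|iW]; split=> //; case/mapP: iW => g gW ->; exact: ltn_idx.
  rewrite big_map big_seq [RHS]big_seq; apply: eq_bigr => g gW.
  pose Bg : pred K := fun k => `[< B g k >].
  rewrite (_ : B g = (fun k => Bg k)); last first.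
    by apply/funext => k; apply/propext; split=> /asboolP.
  rewrite lamE NE -(count_lab Bg); congr (_%:R / _); apply: eq_bigr => e _.
  congr nat_of_bool; apply: asbool_equiv_eq; split; first by apply.
  by move=> Bge h hW /idxI ->.
move=> i iW; rewrite (_ : (\sum_(0 <= e < N'.+1) Bi i e)%N = N'.+1) ?divff ?pnatr_eq0//.
rewrite (eq_bigr (fun=> 1%N)) ?sum_nat_const_nat ?subn0 ?muln1// => e _.
rewrite /Bi asboolT// => g gW gi; exfalso; move/negP: iW; apply.
by rewrite -gi; exact: map_f.
Qed.

Lemma uniform_base_entropy (lambda : probability L R) : uniform_measure lambda ->
  base_entropy lambda = (ln #|K|%:R)%:E.
Proof.
move=> unif; rewrite /base_entropy asboolT; last first.
  exists setT; split=> //; last exact: probability_setT.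
  exact: (@countableP K setT).
have K0 : (0 < #|K|)%N by apply/card_gt0P; exists k0.
have termE (k : L) : entropy_term (lambda [set k]) = (ln #|K|%:R / #|K|%:R)%:E.
  rewrite /entropy_term -[fine _]/(pr lambda [set k]).
  rewrite (_ : [set k] = (fun l => pred1 (k : K) l)); last first.
    by apply/funext => l; apply/propext; split=> /eqP.
  by rewrite unif card1 div1r lnV ?posrE ?ltr0n// mulrN opprK mulrC.
have -> : [set: L] = [set` enum K].
  by apply/seteqP; split=> k //= _; rewrite mem_enum.
have uK : uniq (enum K : seq L) by exact: enum_uniq.
rewrite (esum_seq uK); last first.
  move=> k _; rewrite termE lee_fin.
  have K1 : 1 <= #|K|%:R :> R by rewrite (ler_nat _ 1).
  by apply: divr_ge0; [exact: ln_ge0|exact: ler0n].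
transitivity (\sum_(k <- enum K) (ln #|K|%:R / #|K|%:R : R)%:E)%E.
  by apply: eq_bigr => k _; exact: termE.
rewrite sumEFin big_enum /= sumr_const -[X in X%:E]mulr_natr mulfVK//.
by rewrite pnatr_eq0 -lt0n.
Qed.

End UniformBernoulli.

(** * Approximation by uniform finite bases *)

Section Convergence.
Context (R : realType).

Lemma cvg_sum_seq (I : Type) (s : seq I) (F : I -> nat -> R) (l : I -> R) :
  (forall i, F i n @[n --> \oo] --> l i) ->
  \sum_(i <- s) F i n @[n --> \oo] --> \sum_(i <- s) l i.
Proof.
move=> Fl; elim: s => [|i s IH].
  by under eq_fun do rewrite big_nil; rewrite big_nil; exact: cvg_cst.
by under eq_fun do rewrite big_cons; rewrite big_cons; exact: cvgD.
Qed.

Lemma cvg_prod_seq (I : Type) (s : seq I) (F : I -> nat -> R) (l : I -> R) :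
  (forall i, F i n @[n --> \oo] --> l i) ->
  \prod_(i <- s) F i n @[n --> \oo] --> \prod_(i <- s) l i.
Proof.
move=> Fl; elim: s => [|i s IH].
  by under eq_fun do rewrite big_nil; rewrite big_nil; exact: cvg_cst.
by under eq_fun do rewrite big_cons; rewrite big_cons; exact: cvgM.
Qed.

(** Each [t] receives the integer part of [n.+1%:R * p t] places out of [n.+1]. At most [#|T|]
    places are left over and go to [t0], so each frequency is off by at most
    [#|T|.+1%:R / n.+1%:R]. *)
Lemma rational_labels (T : finType) (p : T -> R) :
  (forall t, 0 <= p t) -> \sum_t p t = 1 ->
  exists f : forall n, 'I_n.+1 -> T, forall t,
    (#|[pred k | f n k == t]|%:R / n.+1%:R : R) @[n --> \oo] --> p t.
Proof.
move=> p0 p1.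
have [t0 _] : exists t0 : T, true.
  have [/eqP T0|/card_gt0P[t _]] := posnP #|T|; last by exists t.
  move: p1; rewrite big1; last by move=> t; have := card0_eq (eqP T0) t; rewrite inE.
  by move=> /eqP; rewrite eq_sym oner_eq0.
pose c n t := Num.truncn (n.+1%:R * p t).
pose s n := flatten [seq nseq (c n t) t | t <- enum T].
pose s' n := s n ++ nseq (n.+1 - size (s n)) t0.
have cP n t : (c n t)%:R <= n.+1%:R * p t < (c n t).+1%:R.
  by apply: Num.Theory.truncn_itv; rewrite mulr_ge0.
have size_s n : size (s n) = (\sum_t c n t)%N.
  rewrite size_flatten /shape -map_comp sumnE big_map big_enum /=.
  by apply: eq_bigr => t _; rewrite size_nseq.
have NE n : n.+1%:R = \sum_t n.+1%:R * p t by rewrite -mulr_sumr p1 mulr1.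
have size_le n : (size (s n) <= n.+1)%N.
  rewrite size_s -(ler_nat R) natr_sum NE.
  by apply: ler_sum => t _; case/andP: (cP n t).
have size_ge n : (n.+1 <= size (s n) + #|T|)%N.
  rewrite size_s -(ler_nat R) natrD natr_sum NE.
  rewrite -sum1_card natr_sum -big_split /=.
  by apply: ler_sum => t _; rewrite -natrD addn1 ltW//; case/andP: (cP n t).
have size_s' n : size (s' n) = n.+1 by rewrite size_cat size_nseq subnKC.
have count_s n t : count_mem t (s n) = c n t.
  rewrite count_flatten -map_comp sumnE big_map big_enum /= (bigD1 t)//= count_nseq /= eqxx mul1n.
  rewrite big1 ?addn0// => u ut; by rewrite count_nseq /= (negbTE ut) mul0n.
exists (fun n k => nth t0 (s' n) k) => t.
have cardE n : #|[pred k : 'I_n.+1 | nth t0 (s' n) k == t]| =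
    (c n t + (t0 == t) * (n.+1 - size (s n)))%N.
  rewrite -count_s -[X in (_ + X)%N](count_nseq (pred1 t)) -count_cat -/(s' n).
  rewrite -sum1_count (big_nth t0) size_s' big_mkord -sum1_card.
  by apply: eq_bigl => k; rewrite inE.
apply: (@squeeze_cvgr _ _ _ _ (fun n => p t - #|T|.+1%:R * harmonic n)
  (fun n => p t + #|T|.+1%:R * harmonic n)).
- apply: nearW => n; rewrite /harmonic /= cardE.
  have n0 : 0 < n.+1%:R :> R by rewrite ltr0n.
  have /andP[h1 h2] := cP n t.
  have h3 : ((t0 == t) * (n.+1 - size (s n)) <= #|T|)%N.
    by case: (_ == _); rewrite ?mul0n// mul1n leq_subLR.
  rewrite ler_pdivlMr// ler_pdivrMr// mulrBl mulrDl -!mulrA mulVf ?gt_eqF// !mulr1.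
  move: h3; rewrite -(ler_nat R) natrD; move: h2; rewrite -!natr1.
  have : 0 <= ((t0 == t) * (n.+1 - size (s n)))%:R :> R by exact: ler0n.
  set X := (_ * _)%:R; set Y := (c n t)%:R in h1 *; set Z := #|T|%:R.
  have : 0 <= Z by exact: ler0n.
  by move: h1; rewrite -natr1; set N := n%:R => h1 Z0 X0 h2 h3; apply/andP; split; lra.
- rewrite -[X in _ --> X]subr0 -[X in _ - X](mulr0 #|T|.+1%:R).
  by apply: cvgB; [exact: cvg_cst|apply: cvgM; [exact: cvg_cst|exact: cvg_harmonic]].
- rewrite -[X in _ --> X]addr0 -[X in _ + X](mulr0 #|T|.+1%:R).
  by apply: cvgD; [exact: cvg_cst|apply: cvgM; [exact: cvg_cst|exact: cvg_harmonic]].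
Qed.

(** By [pr_local] all these probabilities are one and the same polynomial, evaluated at the
    converging letter probabilities. *)
Lemma cvg_pr_local (G : groupType) d (L : measurableType d)
    (lambda : probability L R) (mu : probability (power_space G L) R)
    d' (L_ : nat -> measurableType d') (lambda_ : forall n, probability (L_ n) R)
    (mu_ : forall n, probability (power_space G (L_ n)) R)
    (T : finType) (f : L -> T) (f_ : forall n, L_ n -> T) (W : seq G)
    (A : set (G -> T)) :
  is_power_measure lambda mu -> (forall n, is_power_measure (lambda_ n) (mu_ n)) ->
  (forall t, measurable (f @^-1` [set t])) ->
  (forall n t, measurable (@f_ n @^-1` [set t])) ->
  (forall t, pr (lambda_ n) (@f_ n @^-1` [set t]) @[n --> \oo] -->
     pr lambda (f @^-1` [set t])) ->
  local W A ->
  pr (mu_ n) [set x : G -> L_ n | A (@f_ n \o x)] @[n --> \oo] -->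
    pr mu [set x : G -> L | A (f \o x)].
Proof.
move=> pm pm_ mf mf_ cf lA.
have {}lA : local (undup W) A by apply: local_sub lA => g; rewrite mem_undup.
have uW := undup_uniq W.
rewrite (pr_local pm (f point) uW lA mf).
rewrite (_ : (fun n => _) = fun n => \sum_(u : {ffun 'I_(size (undup W)) -> T})
    if `[< A (extend_values (f point) u) >] then \prod_(g <- undup W)
      pr (lambda_ n) (@f_ n @^-1` [set extend_values (f point) u g]) else 0).
  apply: cvg_sum_seq => u; case: ifP => _; last exact: cvg_cst.
  by apply: cvg_prod_seq => g; exact: cf.
by apply/funext => n; exact: (pr_local (pm_ n) (f point) uW lA (mf_ n)).
Qed.

(** A mark is a fair coin independent of the letter at the same place, so each prescribed mark costs
    a factor 1/2, even at places that [A] depends on. *)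
Lemma pr_local_marks (G : groupType) d (L : measurableType d)
    (lambda : probability L R) (mu : probability (power_space G L) R)
    (T : finType) (f : L -> T) (m : L -> bool) (c : G -> bool) (W V : seq G)
    (A : set (G -> T)) :
  is_power_measure lambda mu -> (forall t, measurable (f @^-1` [set t])) ->
  (forall b, measurable (m @^-1` [set b])) ->
  (forall t b, pr lambda (f @^-1` [set t] `&` m @^-1` [set b]) =
     pr lambda (f @^-1` [set t]) / 2) ->
  uniq V -> local W A ->
  pr mu ([set x : G -> L | A (f \o x)] `&`
      [set x : G -> L | forall v, v \in V -> m (x v) = c v]) =
    2^-1 ^+ size V * pr mu [set x : G -> L | A (f \o x)].
Proof.
move=> pm mf mm fm uV lA.
pose W' := undup (V ++ W); have uW' : uniq W' := undup_uniq _.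
have {}lA : local W' A.
  by apply: local_sub lA => g gW; rewrite mem_undup mem_cat gW orbT.
pose B g := if g \in V then m @^-1` [set c g] else setT.
have mB g : measurable (B g) by rewrite /B; case: ifP.
rewrite [X in _ `&` X](_ : _ = rect W' B); last first.
  apply/seteqP; split=> x; first by move=> h g _; rewrite /B; case: ifP => // /h.
  by move=> h v vV; have := h v; rewrite /B vV mem_undup mem_cat vV; exact.
rewrite (pr_local_rect pm (f point) uW' lA mf mB) (pr_local pm (f point) uW' lA mf).
rewrite mulr_sumr; apply: eq_bigr => u _; case: ifP => _; last by rewrite mulr0.
have -> : 2^-1 ^+ size V = \prod_(g <- W') (if g \in V then 2^-1 else 1 : R).
  rewrite -big_mkcond /= -big_filter (perm_big V).
    by rewrite big_const_seq count_predT iter_mulr_1.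
  apply: uniq_perm => //; first by rewrite filter_uniq.
  by move=> g; rewrite mem_filter mem_undup mem_cat; case: (g \in V).
rewrite -big_split /=; apply: eq_bigr => g _; rewrite /B; case: ifP => _.
  by rewrite fm mulrC.
by rewrite setIT mul1r.
Qed.

End Convergence.

(** * The recoding *)

Section Gibbs.
Context (R : realType).

Lemma entropy_term_gibbs (p w : R) : 0 <= p -> 0 < w ->
  - (p * ln p) <= - (p * ln w) + w - p.
Proof.
rewrite le_eqVlt => /predU1P[<-|p0] w0; first by rewrite !mul0r; lra.
have wp0 : 0 < w / p by rewrite divr_gt0.
have : ln (1 + (w / p - 1)) <= w / p - 1 by apply: le_ln1Dx; lra.
rewrite addrC subrK ln_div ?posrE// -(ler_pM2l p0) !mulrBr mulr1 mulrCA.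
rewrite divff ?gt_eqF// mulr1; lra.
Qed.

(** From [ln (1 + x) >= x / (1 + x)], since [(x - 2 * x ^+ 2) * (1 + x) = x - x ^+ 2 * (1 + 2 * x)];
    the bound [-2^-1] is where the last factor changes sign. *)
Lemma ln1D_ge (x : R) : -2^-1 <= x -> x - 2 * x ^+ 2 <= ln (1 + x).
Proof.
move=> x2; have x1 : 0 < 1 + x by lra.
have i0 : 0 < (1 + x)^-1 by rewrite invr_gt0.
have : ln (1 + ((1 + x)^-1 - 1)) <= (1 + x)^-1 - 1 by apply: le_ln1Dx; lra.
rewrite [1 + (_ - 1)]addrC subrK lnV ?posrE//.
move=> h; have {h} : 1 - (1 + x)^-1 <= ln (1 + x) by lra.
have e : (1 - (1 + x)^-1) * (1 + x) = x.
  by rewrite mulrBl mulVf ?gt_eqF// mul1r addrC addKr.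
by apply: le_trans; rewrite -(ler_pM2r x1) e; nra.
Qed.


End Gibbs.
Lemma sum_pr_fibers (R : realType) d (X : measurableType d) (P : probability X R)
    (U V : finType) (F : X -> U) (phi : U -> V) (c : V -> R) :
  (forall u, measurable (F @^-1` [set u])) ->
  \sum_u pr P (F @^-1` [set u]) * c (phi u) =
  \sum_v pr P ((phi \o F) @^-1` [set v]) * c v.
Proof.
move=> mF.
have mphi v : measurable ((phi \o F) @^-1` [set v]).
  exact: (measurable_fibers (fun u => phi u = v) mF).
transitivity (\sum_v \sum_u pr P ((phi \o F) @^-1` [set v] `&` F @^-1` [set u]) * c v).
  rewrite exchange_big /=; apply: eq_bigr => u _; rewrite (bigD1 (phi u))//=.
  rewrite (_ : _ `&` _ = F @^-1` [set u]); last first.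
    by apply/seteqP; split=> x /=; [case|move=> ->].
  rewrite big1 ?addr0// => v vu; rewrite (_ : _ `&` _ = set0) ?pr_set0 ?mul0r//.
  apply/seteqP; split=> x //= -[] h1 h2; rewrite h2 in h1.
  by rewrite h1 eqxx in vu.
by apply: eq_bigr => v _; rewrite -mulr_suml -pr_sum_fibers.
Qed.

Section FinitePartition.
Context (R : realType) d (X : measurableType d) (P : probability X R).
Context (U : finType) (F : X -> U).
Hypothesis mF : forall u, measurable (F @^-1` [set u]).

(** Empty fibres are left out because [partition] forbids empty blocks; in the entropy they would
    count [0 * ln 0 = 0]. *)
Definition fiber_partition : set (set X) :=
  [set A | A !=set0 /\ exists u, A = F @^-1` [set u]].

Lemma fiber_partition_borel : countable_borel_partition fiber_partition.
Proof.
split.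
- apply: finite_set_countable.
  apply: (@sub_finite_set _ _ [set F @^-1` [set u] | u in [set: U]]).
    by move=> A [_ [u ->]]; exists u.
  by apply: finite_image; exact: finite_finset.
- by move=> A [_ [u ->]].
split.
- apply/seteqP; split=> // x _; exists (F @^-1` [set F x]) => //.
  by split; [exists x|exists (F x)].
- by move=> A B [_ [u ->]] [_ [v ->]] [x [/= <- <-]].
- by move=> A [].
Qed.

Lemma entropy_term_ge0 (A : set X) : measurable A -> (0 <= entropy_term (P A))%E.
Proof.
move=> mA; rewrite lee_fin -[fine _]/(pr P A) oppr_ge0.
have p0 := pr_ge0 P A; have p1 := pr_le1 P mA.
by apply: mulr_ge0_le0 => //; exact: ln_le0.
Qed.

Lemma fiber_partition_entropy : partition_entropy P fiber_partition =
  (\sum_u - (pr P (F @^-1` [set u]) * ln (pr P (F @^-1` [set u]))))%:E.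
Proof.
rewrite /partition_entropy.
pose s : seq U := [seq u <- enum U | `[< F @^-1` [set u] !=set0 >]].
have -> : fiber_partition = [set` [seq F @^-1` [set u] | u <- s]].
  apply/seteqP; split=> A /=.
    move=> [A0 [u Au]]; apply/mapP; exists u => //.
    by rewrite mem_filter mem_enum andbT -Au; apply/asboolP.
  move=> /mapP[u]; rewrite mem_filter => /andP[/asboolP u0 _] ->.
  by split=> //; exists u.
rewrite esum_seq; first last.
- by move=> A /mapP[u _ ->]; exact: entropy_term_ge0.
- rewrite map_inj_in_uniq; first by rewrite filter_uniq// enum_uniq.
  move=> u v; rewrite mem_filter => /andP[/asboolP[x /= xu] _] _ /seteqP[/(_ x xu) /= xv _].
  by rewrite -xu.
rewrite big_map big_filter -big_enum /= -sumEFin big_mkcond; apply: eq_bigr => u _.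
case: asboolP => // u0.
rewrite (_ : _ @^-1` _ = set0) ?pr_set0 ?mul0r ?oppr0//.
by apply/seteqP; split=> x // xu; apply: u0; exists x.
Qed.

End FinitePartition.

Lemma uniform_pr_fst (R : realType) (A : finType) (k0 : A * bool)
    (lambda : probability (@finite_space (A * bool)%type k0) R) (B : pred A) :
  uniform_measure lambda ->
  pr lambda (fun k : A * bool => B k.1) = #|B|%:R / #|A|%:R.
Proof.
move=> unif; transitivity (#|[pred k : A * bool | B k.1]|%:R / #|{: A * bool}|%:R : R).
  exact: (unif [pred k : A * bool | B k.1]).
have -> : #|[pred k : A * bool | B k.1]| = (#|B| * 2)%N.
  by rewrite -card_bool -cardX; apply: eq_card => -[a b]; rewrite !inE andbT.
by rewrite card_prod card_bool !natrM -mulf_div divff ?mulr1// pnatr_eq0.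
Qed.

Lemma uniform_pr_fst_snd (R : realType) (A : finType) (k0 : A * bool)
    (lambda : probability (@finite_space (A * bool)%type k0) R) (B : pred A) b :
  uniform_measure lambda ->
  pr lambda (fun k : A * bool => B k.1 && (k.2 == b)) = #|B|%:R / #|A|%:R / 2.
Proof.
move=> unif; transitivity (#|[pred k : A * bool | B k.1 && (k.2 == b)]|%:R /
    #|{: A * bool}|%:R : R).
  exact: (unif [pred k : A * bool | B k.1 && (k.2 == b)]).
have -> : #|[pred k : A * bool | B k.1 && (k.2 == b)]| = #|B|.
  by rewrite -[RHS]muln1 -(card1 b) -cardX; apply: eq_card => -[a c]; rewrite !inE.
by rewrite card_prod card_bool natrM invfM mulrA.
Qed.

(** * The recoded symbol: decoding, generation and entropy *)

Section Coding.
Context (R : realType) (G : groupType) (A : finZmodType).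
Local Notation K := (A * bool)%type.
Local Notation L := (@finite_space K (0, false)).
Local Notation X := (power_space G L).
Variables (lambda : probability L R) (mu : probability X R).
Hypotheses (unif : uniform_measure lambda) (mulambda : is_power_measure lambda mu).
Hypothesis rokhlin : rokhlin_entropy mu (@bernoulli_shift G _ L) = base_entropy lambda.
Variables (U : finType) (ell : X -> U) (V H : seq G) (E0 : set X) (D : pred A).
Hypothesis mell : forall u, measurable (ell @^-1` [set u]).
Hypothesis mE0 : measurable E0.
Hypothesis E0_det : forall x x' : X,
  (forall h, h \in H -> ell (bernoulli_shift h x) = ell (bernoulli_shift h x')) ->
  (forall v, v \in V -> x v = x' v) -> E0 x -> E0 x'.

Local Notation symbol x := (fst ((x : G -> K) 1%g)).
Local Notation mark x := (snd ((x : G -> K) 1%g)).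

Definition marked_event : set X := E0 `&`
  [set x | mark x = true /\ forall v, v \in V -> ((x : G -> K) v).2 = false].

Lemma measurable_finite_coordinate (g : G) (B : set K) :
  measurable ([set x | B (x g)] : set X).
Proof. exact: (@measurable_coordinate G _ L g B). Qed.

Lemma measurable_marked_event : measurable marked_event.
Proof.
apply: measurableI => //.
rewrite (_ : mkset _ = [set x : X | mark x = true] `&`
    rect V (fun _ => [set k : L | (k : K).2 = false])).
  by apply: measurableI; [exact: (@measurable_finite_coordinate 1%g (fun k => k.2 = true))|
    exact: measurable_rect].
by apply/seteqP; split=> x.
Qed.

Local Notation rho := (#|D|%:R / #|A|%:R : R).

Let pr_symbol : pr mu [set x : X | D (symbol x)] = rho.
Proof.
pose C (g : G) : set L := [set k : L | D (k : K).1].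
rewrite (_ : mkset _ = rect [:: 1%g] C); last first.
  apply/seteqP; split=> x /=; first by move=> Dx g; rewrite inE => /eqP ->.
  by apply; rewrite mem_head.
rewrite (pr_rect mulambda)// big_seq1; exact: (uniform_pr_fst D unif).
Qed.

(* Averaging over [j]: for each symbol exactly [#|D|] of the shifts land in [D]. *)
Lemma exists_recoding_shift : exists j : A,
  pr mu (marked_event `&` [set x : X | D (symbol x + j)]) <=
    rho * pr mu marked_event.
Proof.
apply: contrapT => /forallNP h.
have mM := measurable_marked_event.
pose F (x : X) : A := symbol x.
have mF a : measurable (F @^-1` [set a]).
  exact: (@measurable_finite_coordinate 1%g (fun k => k.1 = a)).
have A0 : 0 < #|A|%:R :> R by rewrite ltr0n; apply/card_gt0P; exists 0.
have mDj j : measurable [set x : X | D (symbol x + j)].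
  exact: (@measurable_finite_coordinate 1%g (fun k => D (k.1 + j))).
have : \sum_(j : A) rho * pr mu marked_event <
    \sum_(j : A) pr mu (marked_event `&` [set x : X | D (symbol x + j)]).
  apply: ltr_sum; last by move=> j _; rewrite ltNge; apply/negP.
  by apply/hasP; exists 0; rewrite ?mem_index_enum.
rewrite sumr_const -[_ *+ _]mulr_natr mulrAC divfK ?gt_eqF//.
have -> : \sum_(j : A) pr mu (marked_event `&` [set x : X | D (symbol x + j)]) =
    \sum_(j : A) \sum_(a : A) pr mu (marked_event `&` F @^-1` [set a]) * (D (a + j))%:R.
  apply: eq_bigr => j _; rewrite (pr_sum_fibers mu mF); last exact: measurableI.
  apply: eq_bigr => a _; have [Da|nDa] := boolP (D (a + j)).
    rewrite mulr1; congr (pr mu _); apply/seteqP; split=> x; first by move=> [[]].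
    by move=> [Ex /= Fx]; split=> //; split=> //=; rewrite -[symbol x]/(F x) Fx.
  rewrite mulr0 (_ : _ `&` _ = set0) ?pr_set0//; apply/seteqP; split=> x //.
  by move=> [[_ /= Dx] Fx]; move/negP: nDa; apply; rewrite -Fx.
rewrite exchange_big /= (eq_bigr (fun a => pr mu (marked_event `&` F @^-1` [set a]) * #|D|%:R)).
  by rewrite -mulr_suml -pr_sum_fibers// mulrC ltxx.
move=> a _; rewrite -mulr_sumr -natr_sum; congr (_ * _%:R).
rewrite -sum1_card [RHS]big_mkcond /= (reindex_inj (@addrI _ (- a))) /=.
by apply: eq_bigr => b _; rewrite addNKr unfold_in; case: (D b).
Qed.

Variable j : A.

Definition recoded (x : X) : K :=
  (symbol x + (if `[< marked_event x >] then j else 0), mark x).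

Definition code (x : X) : (U * K)%type := (ell x, recoded x).

(* The coordinates in [V] of a marked point carry no mark, so [recoded] leaves
   them unchanged; they and the labels decide [marked_event], hence the shift [j]. *)
Lemma code_decodes (x x' : X) :
  (forall h, h \in 1%g :: H ++ [seq v^-1%g | v <- V] ->
    code (bernoulli_shift h x) = code (bernoulli_shift h x')) ->
  x 1%g = x' 1%g.
Proof.
move=> cxx'.
have ell_eq h : h \in H -> ell (bernoulli_shift h x) = ell (bernoulli_shift h x').
  move=> hH; have hin : h \in 1%g :: H ++ [seq v^-1%g | v <- V].
    by rewrite in_cons mem_cat hH orbT.
  exact: (congr1 fst (cxx' h hin)).
have code1 : code x = code x'.
  by have := cxx' 1%g (mem_head _ _); rewrite !bernoulli_shift1.
have mark_eq : mark x = mark x' := congr1 (fun c => c.2.2) code1.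
have codeV v : v \in V -> recoded (bernoulli_shift v^-1%g x) = recoded (bernoulli_shift v^-1%g x').
  move=> vV; have hin : v^-1%g \in 1%g :: H ++ [seq v^-1%g | v <- V].
    by rewrite in_cons mem_cat (map_f (fun v => (v^-1)%g) vV) !orbT.
  exact: (congr1 snd (cxx' _ hin)).
have shV (y : X) v : bernoulli_shift v^-1%g y 1%g = y v.
  by rewrite bernoulli_shiftE invgK mulg1.
have markV v : v \in V -> ((x : G -> K) v).2 = ((x' : G -> K) v).2.
  by move=> /codeV/(congr1 snd); rewrite /= !shV.
have unmarked (y : X) v : ((y : G -> K) v).2 = false ->
    recoded (bernoulli_shift v^-1%g y) = y v.
  move=> yv; rewrite /recoded shV asboolF ?addr0; first by case: ((y : G -> K) v).
  by move=> [_ []] /=; rewrite shV yv.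
have symV : (forall v, v \in V -> ((x : G -> K) v).2 = false) ->
    forall v, v \in V -> x v = x' v.
  move=> hV v vV; rewrite -[LHS]unmarked ?hV// -[RHS]unmarked ?codeV//.
  by rewrite -markV// hV.
have markedE : marked_event x <-> marked_event x'.
  split=> -[E0x [m1 mV]].
    split; first exact: E0_det (symV mV) E0x.
    by split; [rewrite -mark_eq|move=> v vV; rewrite -markV// mV].
  have mV' v : v \in V -> ((x : G -> K) v).2 = false by move=> vV; rewrite markV// mV.
  split; last by rewrite /= mark_eq.
  apply: E0_det E0x; first by move=> h /ell_eq.
  by move=> v vV; apply/esym; exact: symV.
have := congr1 (fun c => c.2.1) code1.
rewrite /= (asbool_equiv_eq markedE) => /addIr h.
by apply: injective_projections.
Qed.

Lemma measurable_code u : measurable (code @^-1` [set u]).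
Proof.
case: u => u [a b].
have mM := measurable_marked_event.
rewrite (_ : _ @^-1` _ = ell @^-1` [set u] `&`
  ((marked_event `&` [set x : X | x 1%g = (a - j, b) :> K]) `|`
   (~` marked_event `&` [set x : X | x 1%g = (a, b) :> K]))).
  apply: measurableI => //; apply: measurableU; apply: measurableI.
  - exact: mM.
  - exact: (@measurable_finite_coordinate 1%g [set (a - j, b)]).
  - exact: measurableC.
  - exact: (@measurable_finite_coordinate 1%g [set (a, b)]).
apply/seteqP; split=> x /=; rewrite /code /recoded.
  move=> [-> <- <-]; split=> //; case: asboolP => Ex; [left|right]; split=> //.
    by rewrite addrK -surjective_pairing.
  by rewrite addr0 -surjective_pairing.
by move=> [-> [[Ex ->]|[Ex ->]]] /=; [rewrite asboolT// subrK|rewrite asboolF// addr0].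
Qed.

(** By [code_decodes] the symbol at 1 is a function of the code at finitely many translates, so all
    events about it lie in the invariant sigma-algebra of the code; their translates are all the
    coordinate sets. *)
Lemma code_generating :
  generating mu (@bernoulli_shift G _ L) (fiber_partition code).
Proof.
have imgE g (B : set X) : bernoulli_shift g @` B = bernoulli_shift g^-1%g @^-1` B.
  apply/seteqP; split=> x /=.
    by move=> [y By <-]; rewrite -bernoulli_shiftM mulVg bernoulli_shift1.
  move=> Bx; exists (bernoulli_shift g^-1%g x) => //.
  by rewrite -bernoulli_shiftM mulgV bernoulli_shift1.
apply/seteqP; split.
  apply: smallest_sub.
    split; first exact: sigma_algebra_measurable.
    by move=> g B mB; rewrite imgE; exact: measurable_shift.
  move=> B [[_ [u ->]]|[]//]; exact: measurable_code.
move=> B mB M [[sM iM] gM].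
have M0 : M set0 by case: sM.
have Mcode h u : M (bernoulli_shift h @^-1` (code @^-1` [set u])).
  rewrite -[h]invgK -imgE; apply: iM.
  have [n0|n0] := pselect ((code @^-1` [set u]) !=set0).
    by apply: gM; left; split=> //; exists u.
  rewrite (_ : _ @^-1` _ = set0)//; apply/seteqP; split=> x // xu.
  by apply: n0; exists x.
have M1 (C : set K) : M [set x : X | C (x 1%g)].
  pose s : seq (set X) := [seq bernoulli_shift h @^-1` (code @^-1` [set u]) |
    h <- 1%g :: H ++ [seq v^-1%g | v <- V], u <- enum {: U * K}].
  apply: (@determined_sigma_algebra X M s) => //.
    by move=> E /allpairsP[[h u] [_ _ ->]]; exact: Mcode.
  move=> x x' hxx' /=; rewrite (@code_decodes x x')// => h hs.
  have := hxx' (bernoulli_shift h @^-1` (code @^-1` [set code (bernoulli_shift h x)])).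
  case; last by move=> /(_ erefl).
  by apply: allpairs_f => //; rewrite mem_enum.
move: B mB; apply: smallest_sub => // B [g [C [_ ->]]].
rewrite (_ : [set x | _] = bernoulli_shift g @` [set x : X | C (x 1%g)]).
  exact: iM.
by rewrite imgE; apply/seteqP; split=> x /=; rewrite bernoulli_shiftE invgK mulg1.
Qed.

(** The recoding changes nothing outside [marked_event]. Inside it, a mass of at least
    [rho * pr mu marked_event + s] on [D] is replaced by at most [rho * pr mu marked_event]. *)
Lemma recoded_deviation (s : R) :
  pr mu (marked_event `&` [set x : X | D (symbol x + j)]) <=
    rho * pr mu marked_event ->
  rho * pr mu marked_event + s <=
    pr mu (marked_event `&` [set x : X | D (symbol x)]) ->
  pr mu [set x : X | D (recoded x).1] <= rho - s.
Proof.
have mM := measurable_marked_event.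
have mDj : measurable [set x : X | D (symbol x + j)].
  exact: (@measurable_finite_coordinate 1%g (fun k => D (k.1 + j))).
have mDs : measurable [set x : X | D (symbol x)].
  exact: (@measurable_finite_coordinate 1%g (fun k => D k.1)).
have mR : measurable [set x : X | D (recoded x).1].
  exact: (measurable_fibers (fun u => D u.2.1) measurable_code).
move=> hj hs.
have E1 : pr mu [set x : X | D (recoded x).1] =
    pr mu (marked_event `&` [set x : X | D (symbol x + j)]) +
    pr mu ([set x : X | D (symbol x)] `\` marked_event).
  rewrite (pr_split mu mR mM); congr (pr mu _ + pr mu _); apply/seteqP; split=> x.
  - by move=> [/= Dx Ex]; split=> //=; move: Dx; rewrite asboolT.
  - by move=> [Ex /= Dx]; split=> //=; rewrite asboolT.
  - by move=> [/= Dx nEx]; split=> //=; move: Dx; rewrite asboolF ?addr0.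
  - by move=> [/= Dx nEx]; split=> //=; rewrite asboolF ?addr0.
have := pr_split mu mDs mM; rewrite pr_symbol setIC E1; move: hj hs.
set x1 := pr mu (_ `&` _); set x2 := pr mu (_ `&` _); set x3 := pr mu (_ `\` _).
by move=> ? ? ?; lra.
Qed.

(** The code is compared by Gibbs with the product weight [W]: [w] on labels, and on symbols the
    uniform law tilted away from [D]. Its entropy is then at most [ln #|K|] plus the cost of the
    labels minus the gain from the tilt, while the hypothesis forces at least [ln #|K|]; hence the
    cost is at least the gain. *)
Lemma coding_entropy (s : R) (w : U -> R) : (forall u, 0 < w u) -> 0 < s ->
  pr mu (marked_event `&` [set x : X | D (symbol x + j)]) <=
    rho * pr mu marked_event ->
  rho * pr mu marked_event + s <=
    pr mu (marked_event `&` [set x : X | D (symbol x)]) ->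
  s ^+ 2 / 8 <= - (\sum_u pr mu (ell @^-1` [set u]) * ln (w u)) + \sum_u w u - 1.
Proof.
move=> w0 s0 hj hs.
have hq := recoded_deviation hj hs.
set q := pr mu _ in hq.
have mR : measurable [set x : X | D (recoded x).1].
  exact: (measurable_fibers (fun u => D u.2.1) measurable_code).
have q0 : 0 <= q := pr_ge0 _ _.
have K0 : 0 < #|{: K}|%:R :> R by rewrite ltr0n; apply/card_gt0P; exists (0, false).
have A0 : 0 < #|A|%:R :> R by rewrite ltr0n; apply/card_gt0P; exists 0.
have rho0 : 0 <= rho by rewrite divr_ge0// ltW.
have rho1 : rho <= 1 by rewrite ler_pdivrMr// mul1r ler_nat max_card.
have q1 : q <= 1 by lra.
have s1 : s <= 1 by lra.
(* The gain will be at least [th * s - 2 * th ^+ 2], which is maximal at [s / 4] with value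
   [s ^+ 2 / 8]. The factors [c1] on [D] and [c0] off it average to 1 under the uniform law;
   [s <= 1] keeps them positive and within reach of [ln1D_ge]. *)
pose th := s / 4.
pose c1 := 1 + - (th * (1 - rho)); pose c0 := 1 + th * rho.
have c10 : 0 < c1 by rewrite /c1 /th; nra.
have c00 : 0 < c0 by rewrite /c0 /th; nra.
pose c (a : A) := if D a then c1 else c0.
have cgt0 a : 0 < c a by rewrite /c; case: ifP.
pose W (l : U * K) := w l.1 * (c l.2.1 / #|{: K}|%:R).
have W0 l : 0 < W l by rewrite mulr_gt0// divr_gt0.
pose p l := pr mu (code @^-1` [set l]).
have p0 l : 0 <= p l := pr_ge0 _ _.
have psum (V' : finType) (phi : U * K -> V') (f : V' -> R) :
    \sum_l p l * f (phi l) = \sum_v pr mu ((phi \o code) @^-1` [set v]) * f v.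
  exact: sum_pr_fibers measurable_code.
have p1 : \sum_l p l = 1.
  rewrite -(pr_setT mu) (pr_sum_fibers mu measurable_code measurableT).
  by apply: eq_bigr => l _; rewrite setTI.
have csum : \sum_(k : K) c k.1 / #|{: K}|%:R = 1.
  rewrite -mulr_suml.
  have -> : \sum_(k : K) c k.1 = \sum_(a : A) 2 * c a.
    rewrite -(pair_bigA _ (fun a _ => c a)) /=; apply: eq_bigr => a _.
    by rewrite sumr_const card_bool mulr_natl.
  rewrite -mulr_sumr (bigID D) /=.
  rewrite (eq_bigr (fun=> c1)); last by move=> a Da; rewrite /c Da.
  rewrite [X in _ + X](eq_bigr (fun=> c0)); last by move=> a; rewrite /c => /negbTE ->.
  rewrite !sumr_const -(mulr_natr c1) -(mulr_natr c0).
  have -> : #|[pred a | ~~ D a]|%:R = #|A|%:R - #|D|%:R :> R.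
    by rewrite -(cardC D) natrD addrC addKr; congr (_%:R); apply: eq_card => a; rewrite !inE.
  rewrite card_prod card_bool natrM /c1 /c0.
  have : #|A|%:R != 0 :> R by rewrite gt_eqF.
  by move=> ?; field.
have Wsum : \sum_l W l = \sum_u w u.
  rewrite -(pair_bigA _ (fun u k => W (u, k))) /=; apply: eq_bigr => u _.
  by rewrite /W /= -mulr_sumr csum mulr1.
have lnW l : ln (W l) = ln (w l.1) + ln (c l.2.1) - ln #|{: K}|%:R.
  by rewrite /W mulrA ln_div ?posrE ?mulr_gt0// lnM ?posrE.
(* The one place where the Rokhlin entropy of the uniform shift is used. *)
have low : ln #|{: K}|%:R <= \sum_l - (p l * ln (p l)).
  rewrite -lee_fin -(fiber_partition_entropy mu measurable_code).
  rewrite -(uniform_base_entropy unif) -rokhlin; apply: ereal_inf_lbound.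
  exists (fiber_partition code) => //; split; last exact: code_generating.
  exact: fiber_partition_borel measurable_code.
have up : \sum_l - (p l * ln (p l)) <= \sum_l (- (p l * ln (W l)) + W l - p l).
  by apply: ler_sum => l _; exact: entropy_term_gibbs.
have := le_trans low up.
rewrite big_split big_split /= sumrN sumrN p1 Wsum.
have -> : \sum_l p l * ln (W l) = \sum_u pr mu (ell @^-1` [set u]) * ln (w u) +
    (q * ln c1 + (1 - q) * ln c0) - ln #|{: K}|%:R.
  rewrite (eq_bigr (fun l =>
    p l * ln (w l.1) + p l * ln (c l.2.1) - p l * ln #|{: K}|%:R)); last first.
    by move=> l _; rewrite lnW mulrBr mulrDr.
  rewrite big_split big_split /= sumrN -mulr_suml p1 mul1r.
  rewrite (psum _ fst (fun u => ln (w u))).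
  congr (_ + _ - _).
  rewrite (psum _ (fun l => D l.2.1) (fun b => ln (if b then c1 else c0))).
  rewrite big_bool /=; congr (_ * _ + _ * _).
  rewrite -(prC mu mR); congr (pr mu _); apply/seteqP; split=> x /=.
    by move=> ->.
  by move/negP/negbTE.
have l1 := @ln1D_ge R (- (th * (1 - rho))) _.
have l0 := @ln1D_ge R (th * rho) _.
have {}l1 : - (th * (1 - rho)) - 2 * (- (th * (1 - rho))) ^+ 2 <= ln c1.
  by apply: l1; rewrite /th; nra.
have {}l0 : th * rho - 2 * (th * rho) ^+ 2 <= ln c0.
  by apply: l0; rewrite /th; nra.
have gain : s ^+ 2 / 8 <= q * ln c1 + (1 - q) * ln c0.
  have th0 : 0 < th by rewrite /th; lra.
  have h1 : q * (- (th * (1 - rho)) - 2 * th ^+ 2) <= q * ln c1.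
    apply: ler_wpM2l => //; apply: le_trans l1; rewrite lerD2l lerN2 ler_pM2l//.
    by rewrite sqrrN exprMn ler_piMr ?sqr_ge0//; nra.
  have h0 : (1 - q) * (th * rho - 2 * th ^+ 2) <= (1 - q) * ln c0.
    apply: ler_wpM2l; first lra.
    apply: le_trans l0; rewrite lerD2l lerN2 ler_pM2l//.
    by rewrite exprMn ler_piMr ?sqr_ge0//; nra.
  apply: le_trans (lerD h1 h0); rewrite (_ : q * (- (th * (1 - rho)) - 2 * th ^+ 2) +
      (1 - q) * (th * rho - 2 * th ^+ 2) = th * (rho - q) - 2 * th ^+ 2); last by ring.
  have : th * s <= th * (rho - q) by rewrite ler_pM2l//; lra.
  by rewrite /th; nra.
set Su := \sum_u pr mu _ * _; set Sw := \sum_u w u; move=> h; lra.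
Qed.

End Coding.

(** * Factors of small entropy *)

Section Factor.
Context (R : realType).

Lemma pr_ae_eq d (X : measurableType d) (P : probability X R) (A A' : set X) :
  measurable A -> measurable A' -> {ae P, forall x, A x <-> A' x} ->
  pr P A = pr P A'.
Proof.
move=> mA mA' [N [mN N0 hN]].
apply/eqP; rewrite -subr_eq0 -normr_le0 (le_trans (pr_dist P mA mA'))//.
have <- : pr P N = 0 by rewrite /pr N0.
apply: pr_le => //; first exact: measurableY.
by move=> x AA'; apply: hN => /= h; case: AA' => -[] /h.
Qed.

Lemma pr_bigcup0 d (X : measurableType d) (P : probability X R) (F : (set X)^nat) :
  (forall n, measurable (F n)) -> (forall n, pr P (F n) = 0) ->
  pr P (\bigcup_n F n) = 0.
Proof.
move=> mF F0; have mU : measurable (\bigcup_n F n) by exact: bigcup_measurable.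
have := measure_sigma_subadditive P mF mU (@subset_refl _ _).
rewrite eseries0; last by move=> n _ _; rewrite -[0]/(0%:E) -(F0 n); exact: prE.
move=> U0; apply/eqP; rewrite eq_le pr_ge0 andbT -lee_fin -prE//.
Qed.

(** If all events had probability 0 or 1, then at each radius one ball of a countable cover would
    have full measure; the intersection of these balls over all radii would be a single point of
    measure 1. *)
Lemma nontrivial_set d (Y : measurableType d) (nu : probability Y R) :
  standard_borel R Y -> ~ (exists y, nu [set y] = 1%E) ->
  exists B, measurable B /\ 0 < pr nu B < 1.
Proof.
move=> [M [f [_ [D /countable_injP[i iinj] dD] [g fg gf] mE]]] natom.
apply: contrapT => /forallNP triv.
have zero_one B : measurable B -> pr nu B != 0 -> pr nu B = 1.
  move=> mB B0; apply/eqP; rewrite eq_le pr_le1//= leNgt; apply/negP => B1.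
  by apply: (triv B); split=> //; rewrite B1 lt_neqAle eq_sym B0 pr_ge0.
(* At most one point of [D] has index [k], so this is the interior of one ball, or empty when [k] is
   no index; the dense set is enumerated without inverting [i]. *)
pose O k n : set M := \bigcup_(x in [set x | D x /\ i x = k]) (ball x (n.+1%:R^-1 : R))°.
have mO k n : measurable (f @^-1` O k n).
  apply/mE; rewrite image_preimage; last first.
    by apply/seteqP; split=> // x _; exists (g x).
  by apply: sub_gen_smallest; apply: bigcup_open => x _; exact: open_interior.
have covO n : \bigcup_k (f @^-1` O k n) = setT.
  apply/seteqP; split=> // y _.
  have r0 : 0 < n.+1%:R^-1 :> R by rewrite invr_gt0.
  have r20 : 0 < n.+1%:R^-1 / 2 :> R by rewrite divr_gt0.
  have [x [yx Dx]] : (ball (f y) (n.+1%:R^-1 / 2 : R))° `&` D !=set0.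
    apply: dD; last exact: open_interior.
    by exists (f y); exact: nbhsx_ballx.
  exists (i x) => //; exists x => //=.
  apply: filterS (nbhsx_ballx (f y) _ r20) => z yz.
  rewrite (splitr n.+1%:R^-1); apply: ball_triangle yz.
  by apply: ball_sym; exact: interior_subset yx.
have full n : exists k, pr nu (f @^-1` O k n) = 1.
  apply: contrapT => /forallNP h.
  have : pr nu (\bigcup_k (f @^-1` O k n)) = 0.
    apply: pr_bigcup0 => // k.
    have [//|/zero_one h1] := eqVneq (pr nu (f @^-1` O k n)) 0.
    by case: (h k); exact: h1.
  by rewrite covO pr_setT => /eqP; rewrite oner_eq0.
have [k hk] := choice full.
pose Z := \bigcap_n (f @^-1` O (k n) n).
have mZ : measurable Z by exact: bigcapT_measurable.
have Z1 : nu Z = 1%E.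
  rewrite prE//; congr (_%:E).
  have : pr nu (~` Z) = 0.
    rewrite /Z setC_bigcap; apply: pr_bigcup0 => n; first exact: measurableC.
    by rewrite prC// hk subrr.
  by rewrite prC// => /eqP; rewrite subr_eq0 => /eqP.
apply: natom; have [[y Zy]|nZ] := pselect (Z !=set0); last first.
  move: Z1; rewrite (_ : Z = set0) ?measure0; last first.
    by apply/seteqP; split=> x // Zx; apply: nZ; exists x.
  by move/eqP; rewrite eq_sym onee_eq0.
exists y; rewrite -Z1; congr (nu _); apply/seteqP; split=> [_ -> //|y' Zy' /=].
suff : f y = f y' by move/(congr1 g); rewrite !fg.
apply: mdist_positivity; apply/eqP; rewrite eq_le mdist_ge0 andbT.
apply/ler_addgt0Pr => e e0; rewrite add0r.
have e20 : 0 < e / 2 by rewrite divr_gt0.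
have [n _ /(_ n (leqnn n)) /= hn] := (cvgrPdist_lt _ _).1 (@cvg_harmonic R) _ e20.
have [x [Dx ix] /interior_subset yx] := Zy n I.
have [x' [Dx' ix'] /interior_subset yx'] := Zy' n I.
have xx' : x = x' by apply: iinj; rewrite ?inE// ix ix'.
move: yx yx'; rewrite -xx' !ballEmdist /= => h1 h2.
move: hn; rewrite sub0r normrN /harmonic /= ger0_norm ?invr_ge0// => hn.
have := metric_triangle (f y) x (f y'); rewrite [mdist (f y) x]metric_sym.
move=> tri; apply: le_trans tri _; rewrite (splitr e) ltW// ltrD//.
  exact: lt_trans h1 hn.
exact: lt_trans h2 hn.
Qed.

Context (G : groupType).

(** The approximable events form a sigma-algebra containing [alpha] and the null sets. It is
    invariant because [b] preserves [nu] and carries translates of blocks to translates of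
    blocks. *)
Lemma generating_approximable d (Y : measurableType d) (nu : probability Y R)
    (b : G -> Y -> Y) (alpha : set (set Y)) :
  is_pmp_action nu b -> countable_borel_partition alpha ->
  generating nu b alpha ->
  forall B, measurable B ->
    approximable nu [set A | exists h C, alpha C /\ A = b h @^-1` C] B.
Proof.
move=> [b1 bM mb pb] [_ malpha _] gen B.
have mpre h C : measurable C -> measurable (b h @^-1` C).
  by move=> mC; rewrite -[X in measurable X]setTI; exact: mb.
set GG := [set A | _].
have mGG : GG `<=` measurable by move=> _ [h [C [/malpha mC ->]]]; exact: mpre.
rewrite -gen; apply: smallest_sub; last first.
  move=> C [aC|[mC C0]]; last exact: approximable_null.
  apply: approximable_gen => //; exists 1%g, C; split=> //.
  by apply/seteqP; split=> x /=; rewrite b1.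
split; first exact: approximable_sigma.
move=> g A [mA aA].
have imgE : b g @` A = b g^-1%g @^-1` A.
  apply/seteqP; split=> x /=; first by move=> [y Ay <-]; rewrite -bM mulVg b1.
  by move=> Ax; exists (b g^-1%g x); rewrite // -bM mulgV b1.
rewrite imgE; split; first exact: mpre.
move=> e e0; have [s [A' [sG sA' eA]]] := aA _ e0.
have mA' : measurable A' by apply: determined_measurable sA' => C /sG /mGG.
exists [seq b g^-1%g @^-1` C | C <- s], (b g^-1%g @^-1` A'); split.
- move=> _ /mapP[C /sG[h [E [aE ->]]] ->]; exists (h * g^-1)%g, E; split=> //.
  by apply/seteqP; split=> x /=; rewrite bM.
- move=> x y h; apply: sA' => C Cs; apply: (h (b g^-1%g @^-1` C)).
  exact: map_f.
- by rewrite -[_ `+` _]/(b g^-1%g @^-1` (A `+` A')) /pr pb//; exact: measurableY.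
Qed.

Lemma translates_determined (Y : Type) (b : G -> Y -> Y) (alpha : set (set Y))
    (s : seq (set Y)) (A : set Y) :
  (forall B, B \in s -> exists h C, alpha C /\ B = b h @^-1` C) ->
  determined s A -> exists (hs : seq G) (Cs : seq (set Y)),
    (forall C, C \in Cs -> alpha C) /\
    forall y y', (forall h C, h \in hs -> C \in Cs -> C (b h y) <-> C (b h y')) ->
      A y -> A y'.
Proof.
move=> hs sA.
suff [Hs [Cs [aCs hCs]]] : exists (Hs : seq G) (Cs : seq (set Y)),
    (forall C, C \in Cs -> alpha C) /\ forall B, B \in s -> exists h C,
      [/\ h \in Hs, C \in Cs & B = b h @^-1` C].
  exists Hs, Cs; split=> // y y' h; apply: sA => B /hCs[k [C [kH CC ->]]].
  exact: h.
elim: s hs {sA} => [|B s IH] hs; first by exists [::], [::].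
have [|Hs [Cs [aCs hCs]]] := IH.
  by move=> C Cs; apply: hs; rewrite in_cons Cs orbT.
have [h [C [aC BE]]] := hs B (mem_head _ _).
exists (h :: Hs), (C :: Cs); split.
  by move=> E; rewrite in_cons => /predU1P[->//|/aCs].
move=> E; rewrite in_cons => /predU1P[->|/hCs[k [F [kH FC ->]]]].
  by exists h, C; rewrite !mem_head.
by exists k, F; rewrite !in_cons kH FC !orbT.
Qed.

End Factor.

(** * Labels of small cost and their local approximation *)

Section Labels.
Context (R : realType).

Lemma partition_tail d (Y : measurableType d) (nu : probability Y R)
    (alpha : set (set Y)) (k : R) :
  countable_borel_partition alpha -> 0 < k ->
  exists s : seq (set Y), (forall C, C \in s -> alpha C) /\
    pr nu [set y | forall C, C \in s -> ~ C y] < k.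
Proof.
move=> [/countable_injP[i iinj] malpha [calpha _ _]] k0.
pose e n : set Y := get [set C | alpha C /\ i C = n].
have eE C : alpha C -> e (i C) = C.
  move=> aC; have [ae ie] : [set C' | alpha C' /\ i C' = i C] (e (i C)).
    by apply: getPex; exists C.
  by apply: iinj; rewrite ?inE.
(* For [n] outside the range of [i] on [alpha], [e n] is the default value of [get]; the filter
   removes it unless it happens to be a block. *)
pose s n := [seq C <- map e (iota 0 n) | `[< alpha C >]].
have sa n C : C \in s n -> alpha C.
  by rewrite mem_filter => /andP[/asboolP].
have smem n C : alpha C -> (i C < n)%N -> C \in s n.
  move=> aC iC; rewrite mem_filter; apply/andP; split; first exact/asboolP.
  by apply/mapP; exists (i C); rewrite ?mem_iota// eE.
have ssub m n : (m <= n)%N -> {subset s m <= s n}.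
  move=> mn C; rewrite !mem_filter => /andP[-> /mapP[j]].
  rewrite mem_iota /= => jm ->; apply/map_f; rewrite mem_iota /=.
  exact: leq_trans jm mn.
pose F n : set Y := [set y | exists2 C, C \in s n & C y].
have mF n : measurable (F n) by apply: measurable_exists => C /sa/malpha.
have FU : \bigcup_n F n = setT.
  apply/seteqP; split=> // y _.
  have : cover alpha id y by rewrite calpha.
  by move=> [C aC Cy]; exists (i C).+1 => //; exists C => //; exact: smem.
have ndF : nondecreasing_seq F.
  by move=> m n mn; apply/subsetPset => y [C /(ssub _ _ mn) Cs Cy]; exists C.
have cF : pr nu (F n) @[n --> \oo] --> (1 : R).
  apply: fine_cvg; rewrite -(probability_setT nu) -FU.
  by apply: nondecreasing_cvg_mu => //; rewrite FU.
have [n _ /(_ n (leqnn n)) /= hn] := (cvgrPdist_lt _ _).1 cF _ k0.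
exists (s n); split; first exact: sa.
rewrite (_ : mkset _ = ~` F n); last first.
  by apply/seteqP; split=> y /= h; [move=> [C /h]|move=> C Cs Cy; apply: h; exists C].
rewrite prC//; exact: le_lt_trans (ler_norm _) hn.
Qed.

Lemma partition_entropy_ge d (Y : measurableType d) (nu : probability Y R)
    (alpha : set (set Y)) (s : seq (set Y)) :
  uniq s -> (forall C, C \in s -> alpha C) ->
  ((\sum_(C <- s) - (pr nu C * ln (pr nu C)))%:E <= partition_entropy nu alpha)%E.
Proof.
move=> us sa; rewrite -sumEFin; apply: esum_ge; exists [set` s].
  by split; [exact: finite_seq|move=> C /= /sa].
by rewrite -(fsbig_seq _ _ us).
Qed.

(* The label [i < r] stands for the [i]-th listed set, [r] for their complement;
   the weights are the probabilities, fattened so as to be positive. *)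
Lemma cheap_labels d (Y : measurableType d) (nu : probability Y R)
    (alpha : set (set Y)) (Cs : seq (set Y)) (t : R) :
  countable_borel_partition alpha -> (partition_entropy nu alpha < t%:E)%E ->
  (forall C, C \in Cs -> alpha C) -> 0 < t ->
  exists (r : nat) (ell : Y -> 'I_r.+1) (w : 'I_r.+1 -> R),
    [/\ forall u, measurable (ell @^-1` [set u]),
      forall C y y', C \in Cs -> ell y = ell y' -> C y -> C y',
      forall u, 0 < w u, \sum_u w u <= 1 + 2 * t &
      - (\sum_u pr nu (ell @^-1` [set u]) * ln (w u)) <= 2 * t].
Proof.
move=> Palpha Ht aCs t0.
pose k := t / (1 + `|ln t|).
have l0 : 0 < 1 + `|ln t| by rewrite ltr_pwDl.
have k0 : 0 < k by rewrite divr_gt0.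
have [s0 [as0 hs0]] := partition_tail nu Palpha k0.
have [_ malpha [_ talpha _]] := Palpha.
pose s := undup (Cs ++ s0); have us : uniq s := undup_uniq _.
have sa C : C \in s -> alpha C.
  by rewrite mem_undup mem_cat => /orP[/aCs|/as0].
pose r := size s.
pose ell y : 'I_r.+1 := inord (find (fun C : set Y => `[< C y >]) s).
have ellE y : ell y = find (fun C : set Y => `[< C y >]) s :> nat.
  by rewrite inordK// ltnS find_size.
have sn (u : nat) : (u < r)%N -> nth set0 s u \in s by exact: mem_nth.
have fiberE (u : 'I_r.+1) : (u < r)%N -> ell @^-1` [set u] = nth set0 s u.
  move=> ur; apply/seteqP; split=> y /=.
    move=> uE; have h : has (fun C : set Y => `[< C y >]) s.
      by rewrite has_find -ellE uE.
    by have /asboolP := nth_find set0 h; rewrite -ellE uE.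
  move=> yu; have h : has (fun C : set Y => `[< C y >]) s.
    by apply/hasP; exists (nth set0 s u); [exact: sn|exact/asboolP].
  have /asboolP := nth_find set0 h; rewrite -ellE => yl.
  have lr : (ell y < r)%N by rewrite ellE -has_find.
  apply: val_inj; apply/eqP; rewrite -(nth_uniq set0 lr ur us); apply/eqP.
  by apply: talpha; [exact/sa/sn|exact/sa/sn|exists y].
have fiberM : ell @^-1` [set ord_max] `<=` [set y | forall C, C \in s0 -> ~ C y].
  move=> y /(congr1 val) /= yr C Cs0 Cy.
  suff : (find (fun C : set Y => `[< C y >]) s < r)%N by rewrite -ellE yr ltnn.
  rewrite -has_find; apply/hasP; exists C; last exact/asboolP.
  by rewrite mem_undup mem_cat Cs0 orbT.
have lastE (u : 'I_r.+1) : ~~ (u < r)%N -> u = ord_max.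
  by move=> ur; apply: val_inj; apply/eqP; rewrite eqn_leq -ltnS ltn_ord leqNgt.
have mtail : measurable [set y | forall C, C \in s0 -> ~ C y].
  rewrite (_ : mkset _ = ~` [set y | exists2 C, C \in s0 & C y]).
    by apply: measurableC; apply: measurable_exists => C /as0/malpha.
  by apply/seteqP; split=> y /= h; [move=> [C /h]|move=> C Cs1 Cy; apply: h; exists C].
have mell u : measurable (ell @^-1` [set u]).
  have [ur|/lastE ->] := boolP (u < r)%N; first by rewrite fiberE//; exact/malpha/sa/sn.
  rewrite (_ : _ @^-1` _ = ~` [set y | exists2 C, C \in s & C y]).
    by apply: measurableC; apply: measurable_exists => C /sa/malpha.
  apply/seteqP; split=> y /=.
    move=> yM [C Cs1 Cy]; suff : (ell y < r)%N by rewrite yM ltnn.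
    by rewrite ellE -has_find; apply/hasP; exists C => //; exact/asboolP.
  move=> h; apply: lastE; rewrite ellE -has_find; apply/negP => /hasP[C Cs1 /asboolP Cy].
  by apply: h; exists C.
pose p u := pr nu (ell @^-1` [set u]).
have p0 u : 0 <= p u := pr_ge0 _ _.
have psum : \sum_u p u = 1.
  rewrite -(pr_setT nu) (pr_sum_fibers nu mell measurableT).
  by apply: eq_bigr => u _; rewrite setTI.
pose w (u : 'I_r.+1) := if (u < r)%N then p u + t / r.+1%:R else t.
have r0 : 0 < r.+1%:R :> R by rewrite ltr0n.
have tr0 : 0 < t / r.+1%:R by rewrite divr_gt0.
have plast : p ord_max < k by apply: le_lt_trans hs0; exact: pr_le.
exists r, ell, w; split => //.
- move=> C y y' CCs yy' Cy.
  have Cs1 : C \in s by rewrite mem_undup mem_cat CCs.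
  have ir : (index C s < r.+1)%N by rewrite ltnS index_size.
  have fE := fiberE (Ordinal ir); rewrite /= index_mem in fE.
  have {}fE := fE Cs1; rewrite nth_index// in fE.
  have yi : (ell @^-1` [set Ordinal ir]) y by rewrite fE.
  by rewrite -fE /= -yy'.
- by move=> u; rewrite /w; case: ifP => // _; rewrite ltr_wpDl.
- apply: (@le_trans _ _ (\sum_u (p u + t / r.+1%:R) + t)).
    rewrite !big_ord_recr /= {2}/w ltnn lerD2r -[leLHS]addr0; apply: lerD.
      by apply: ler_sum => i _; rewrite /w /= ltn_ord.
    by rewrite addr_ge0// ltW.
  rewrite big_split /= psum sumr_const card_ord -[_ *+ _]mulr_natr divfK ?gt_eqF//.
  by rewrite mulr_natl mulr2n addrA.
have Hs : \sum_(i < r) - (p (widen_ord (leqnSn r) i) * ln (p (widen_ord (leqnSn r) i))) <= t.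
  rewrite -lee_fin (le_trans _ (ltW Ht))// (le_trans _ (partition_entropy_ge nu us sa))//.
  rewrite (big_nth set0) big_mkord lee_fin le_eqVlt; apply/orP; left; apply/eqP.
  by apply: eq_bigr => i _; rewrite /p fiberE//=.
rewrite big_ord_recr /= opprD (_ : 2 * t = t + t) ?mulr_natl//; apply: lerD.
  apply: le_trans Hs; rewrite -sumrN; apply: ler_sum => i _.
  rewrite -/(p _) /w /= ltn_ord lerN2.
  have [->|pi0] := eqVneq (p (widen_ord (leqnSn r) i)) 0; first by rewrite !mul0r.
  have pi : 0 < p (widen_ord (leqnSn r) i) by rewrite lt_neqAle eq_sym pi0 p0.
  by rewrite ler_wpM2l// ler_ln ?posrE ?addr_gt0// lerDl ltW.
rewrite -/(p _) /w ltnn -mulrN.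
apply: (@le_trans _ _ (k * `|ln t|)).
  apply: (@le_trans _ _ (p ord_max * `|ln t|)).
    by apply: ler_wpM2l => //; rewrite -normrN ler_norm.
  by apply: ler_wpM2r => //; exact: ltW.
rewrite /k mulrAC ler_pdivrMr//.
by apply: ler_wpM2l; [exact: ltW|rewrite lerDr].
Qed.

(** Each fibre of [ell] is approximated by a local event with error [e / r.+1%:R]; off the union of
    the errors exactly one of these events holds, and it names the label. [Cs'] is left open so that
    further sets can join the alphabet. *)
Lemma approximate_labels (G : groupType) d (L : measurableType d)
    (mu : probability (power_space G L) R) (r : nat)
    (ell : power_space G L -> 'I_r.+1) (e : R) :
  (forall u, measurable (ell @^-1` [set u])) -> 0 < e ->
  exists (Cs : seq (set L)) (W : seq G), (forall C, C \in Cs -> measurable C) /\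
    forall Cs', {subset Cs <= Cs'} -> (forall C, C \in Cs' -> measurable C) ->
    exists ell' : (G -> {ffun 'I_(size Cs') -> bool}) -> 'I_r.+1,
      (forall z z', (forall w, w \in W -> z w = z' w) -> ell' z = ell' z') /\
      pr mu [set x : G -> L | ell' (signature Cs' \o x) != ell x] <= e.
Proof.
move=> mell e0.
have er0 : 0 < e / r.+1%:R by rewrite divr_gt0// ltr0n.
have approx u : exists CW : seq (set L) * seq G, (forall C, C \in CW.1 -> measurable C) /\
    forall Cs' W', {subset CW.1 <= Cs'} -> {subset CW.2 <= W'} ->
    exists A' : set (G -> {ffun 'I_(size Cs') -> bool}), local W' A' /\
      ((forall C, C \in Cs' -> measurable C) ->
      pr mu ((ell @^-1` [set u]) `+` [set x : G -> L | A' (signature Cs' \o x)]) < e / r.+1%:R).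
  have [s [A [sG sA eA]]] := (coordinate_approximable mu (mell u)).2 _ er0.
  have [Cs [W [mCs h]]] := coordinate_determined_local sG sA.
  exists (Cs, W); split=> // Cs' W' h1 h2; have [A' [lA' AE]] := h Cs' W' h1 h2.
  by exists A'; split=> // _; rewrite -AE.
have [CW hCW] := choice approx.
pose Cs := flatten [seq (CW u).1 | u <- enum 'I_r.+1].
pose W := flatten [seq (CW u).2 | u <- enum 'I_r.+1].
exists Cs, W; split.
  by move=> C /flatten_mapP[u _]; exact: (hCW u).1.
move=> Cs' CsCs' mCs'.
have sub1 u : {subset (CW u).1 <= Cs'}.
  by move=> C CC; apply: CsCs'; apply/flatten_mapP; exists u => //; rewrite mem_enum.
have sub2 u : {subset (CW u).2 <= W}.
  by move=> g gW; apply/flatten_mapP; exists u => //; rewrite mem_enum.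
have [A' hA'] := choice (fun u => (hCW u).2 Cs' W (sub1 u) (sub2 u)).
(* Where none of the approximating events holds the label is the default [ord0]; such points count
   as errors. *)
pose ell' (z : G -> {ffun 'I_(size Cs') -> bool}) : 'I_r.+1 :=
  odflt ord0 [pick u | `[< A' u z >]].
have ell'W z z' : (forall w, w \in W -> z w = z' w) -> ell' z = ell' z'.
  move=> zz'; rewrite /ell'; congr (odflt _ _); apply: eq_pick => u.
  apply: asbool_equiv_eq; split; apply: (hA' u).1 => // w wW.
  by apply/esym; exact: zz'.
exists ell'; split=> //.
have msig := measurable_signature mCs'.
have mB u : measurable ([set x : G -> L | A' u (signature Cs' \o x)] : set (power_space G L)).
  exact: measurable_local msig (hA' u).1.
have mY u := measurableY (mell u) (mB u).
pose E u : set (power_space G L) :=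
  (ell @^-1` [set u]) `+` [set x : G -> L | A' u (signature Cs' \o x)].
have sub : [set x : power_space G L | ell' (signature Cs' \o x) != ell x] `<=`
    [set x | exists2 u, u \in enum 'I_r.+1 & E u x].
  move=> x /= hx; apply: contrapT => nh.
  have h u : A' u (signature Cs' \o x) <-> ell x = u.
    have nY : ~ ((ell @^-1` [set u]) `+` [set x : G -> L | A' u (signature Cs' \o x)]) x.
      by move=> hY; apply: nh; exists u => //; rewrite mem_enum.
    split=> hu; apply: contrapT => nu; apply: nY; [right|left]; by split.
  move/eqP: hx; apply; rewrite /ell'; case: pickP => [u /asboolP /h //|/(_ (ell x))].
  by move=> /negP; case; apply/asboolP/h.
apply: le_trans (pr_le mu _ _ sub) _.
- have -> : [set x : G -> L | ell' (signature Cs' \o x) != ell x] =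
    ~` [set x : G -> L | exists2 u, u \in enum 'I_r.+1 &
      (ell @^-1` [set u] `&` [set x : G -> L | ell' (signature Cs' \o x) = u]) x].
    apply/seteqP; split=> x /=.
      by move=> /eqP h [u _ [<- /h]].
    move=> h; apply/eqP => xE; apply: h; exists (ell x); rewrite ?mem_enum//.
  apply: measurableC; apply: measurable_exists => u _; apply: measurableI => //.
  apply: (measurable_local (W := W) (A := [set z | ell' z = u]) msig) => z z' zz' /= <-.
  by apply/esym; exact: ell'W.
- by apply: measurable_exists => u _; exact: mY.
apply: le_trans (pr_exists_le mu (fun u (_ : u \in enum 'I_r.+1) => mY u)) _.
apply: (@le_trans _ _ (\sum_(u <- enum 'I_r.+1) e / r.+1%:R)).
  by apply: ler_sum => u _; apply: ltW; exact: (hA' u).2.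
by rewrite big_enum /= sumr_const card_ord -[_ *+ _]mulr_natr divfK// pnatr_eq0.
Qed.

(** The shift by [g] carries the coordinate [g] to 1, the window to [g^-1 * V] and the event of [Y]
    to its preimage under [b g], up to a null set. *)
Lemma dependence_at_identity (G : groupType) d (L : measurableType d)
    (lambda : probability L R) (mu : probability (power_space G L) R)
    d' (Y : measurableType d') (nu : probability Y R) (b : G -> Y -> Y)
    (phi : power_space G L -> Y) :
  is_power_measure lambda mu -> standard_borel R Y -> is_pmp_action nu b ->
  is_factor_map mu (@bernoulli_shift G d L) nu b phi ->
  ~ (exists y, nu [set y] = 1%E) ->
  exists (D : set L) (V : seq G) (C : G -> set L) (B : set Y) (e : R),
    [/\ measurable D, forall h, measurable (C h), uniq (1%g :: V), measurable B & 0 < e /\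
      pr lambda D * pr mu (rect V C `&` phi @^-1` B) + e <=
      pr mu ([set x : G -> L | D (x 1%g)] `&` (rect V C `&` phi @^-1` B))].
Proof.
move=> pm sY [b1 bM mb pb] [mphi pphi ephi] natom.
have mpre (B : set Y) : measurable B -> measurable (phi @^-1` B).
  by move=> mB; rewrite -[X in measurable X]setTI; exact: mphi.
have [B0 [mB0 B01]] := nontrivial_set sY natom.
have [|g [D [V [C [mD mC uV gV neq]]]]] := nontrivial_dependence pm (mpre _ mB0).
  by rewrite /pr pphi.
pose V1 := [seq (g^-1 * h)%g | h <- V].
pose C1 h := C (g * h)%g.
pose B := b g @^-1` B0.
have mB : measurable B by rewrite -[X in measurable X]setTI; exact: mb.
have mC1 h : measurable (C1 h) by exact: mC.
have uV1 : uniq (1%g :: V1).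
  rewrite /= map_inj_uniq ?uV ?andbT//; last exact: mulgI.
  by apply/negP => /mapP[h hV]; move=> /(congr1 (fun k => (g * k)%g));
    rewrite mulg1 mulVKg => gh; rewrite gh hV in gV.
pose Q : set (power_space G L) := rect V1 C1 `&` phi @^-1` B.
have mQ : measurable Q by apply: measurableI; [exact: measurable_rect|exact: mpre].
have aeP : {ae mu, forall x, (phi @^-1` B0) (bernoulli_shift g x) <-> (phi @^-1` B) x}.
  by apply: filterS (ephi g) => x /= ->.
have rectE (x : power_space G L) : rect V C (bernoulli_shift g x) <-> rect V1 C1 x.
  split=> h.
    by move=> _ /mapP[k kV ->]; rewrite /C1 mulVKg; exact: h.
  move=> k kV; have := h _ (map_f (fun h => (g^-1 * h)%g) kV).
  by rewrite /C1 mulVKg.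
have mD1 (E : set L) : measurable E -> measurable ([set x : G -> L | E (x 1%g)] : set (power_space G L)).
  exact: measurable_coordinate.
have mRP : measurable (rect V C `&` phi @^-1` B0 : set (power_space G L)).
  by apply: measurableI; [exact: measurable_rect|exact: mpre].
have eQ : pr mu (rect V C `&` phi @^-1` B0) = pr mu Q.
  rewrite -(pr_shift pm g mRP); apply: pr_ae_eq => //; first exact: measurable_shift.
  by apply: filterS aeP => x /= h; rewrite /Q /setI /= rectE h.
have eDQ : pr mu ([set x : G -> L | D (x g)] `&` rect V C `&` phi @^-1` B0) =
    pr mu ([set x : G -> L | D (x 1%g)] `&` Q).
  rewrite -setIA -(pr_shift pm g); last by apply: measurableI => //; exact: measurable_coordinate.
  apply: pr_ae_eq.
    by apply: measurable_shift; apply: measurableI => //; exact: measurable_coordinate.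
    by apply: measurableI => //; exact: mD1.
  apply: filterS aeP => x /= h; rewrite /Q /setI /= rectE h bernoulli_shiftE mulVg.
  by [].
rewrite eQ eDQ in neq.
have mDQ := measurableI _ _ (mD1 _ mD) mQ.
have [lt|ge] := ltP (pr lambda D * pr mu Q) (pr mu ([set x : G -> L | D (x 1%g)] `&` Q)).
  exists D, V1, C1, B, (pr mu ([set x : G -> L | D (x 1%g)] `&` Q) - pr lambda D * pr mu Q).
  by split=> //; rewrite subr_gt0 lt; split=> //; rewrite addrC subrK.
(* A deficit on [D] is an excess of the same size on its complement. *)
exists (~` D), V1, C1, B, (pr lambda D * pr mu Q - pr mu ([set x : G -> L | D (x 1%g)] `&` Q)).
split=> //; first exact: measurableC.
rewrite subr_gt0 lt_neqAle neq ge; split=> //; rewrite -/Q.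
have := pr_split mu mQ (mD1 _ mD); rewrite setIC => ->.
rewrite (_ : Q `\` _ = [set x : G -> L | (~` D) (x 1%g)] `&` Q); last first.
  by apply/seteqP; split=> x [].
rewrite prC//.
set a := pr mu _; set a' := pr mu _; set l := pr lambda D.
by rewrite le_eqVlt; apply/orP; left; apply/eqP; ring.
Qed.

End Labels.

(** * Reduction to a finite base *)

(** The shift on patterns over a finite alphabet, with no measurable structure on [T]. *)
Definition translate (G : groupType) (T : Type) (h : G) (z : G -> T) : G -> T :=
  fun k => z (h^-1 * k)%g.

Lemma local_translates (G : groupType) (T U : Type) (ell : (G -> T) -> U)
    (V W hs : seq G) (E : set (G -> T)) :
  (forall z z', (forall w, w \in W -> z w = z' w) -> ell z = ell z') ->
  (forall z z', (forall h, h \in hs -> ell (translate h z) = ell (translate h z')) ->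
    (forall v, v \in V -> z v = z' v) -> E z -> E z') ->
  local (V ++ [seq (h^-1 * w)%g | h <- hs, w <- W]) E.
Proof.
move=> ellW Edet z z' zz'; apply: Edet.
  move=> h hhs; apply: ellW => w wW; apply: zz'.
  by rewrite mem_cat (allpairs_f (fun h w => (h^-1 * w)%g) hhs wW) orbT.
by move=> v vV; apply: zz'; rewrite mem_cat vV.
Qed.

Section SymbolicModel.
Context (R : realType) (G : groupType) d (L : measurableType d).
Variables (lambda : probability L R) (mu : probability (power_space G L) R).
Hypothesis mulambda : is_power_measure lambda mu.
Context d' (Y : measurableType d') (nu : probability Y R) (b : G -> Y -> Y).
Variable phi : power_space G L -> Y.
Hypotheses (sY : standard_borel R Y) (bY : is_pmp_action nu b).
Hypothesis phiY : is_factor_map mu (@bernoulli_shift G d L) nu b phi.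

Lemma ae_seq (hs : seq G) : exists N, [/\ measurable N, mu N = 0%E &
  forall x, ~ N x -> forall h, h \in hs -> phi (bernoulli_shift h x) = b h (phi x)].
Proof.
elim: hs => [|h hs [N [mN N0 hN]]]; first by exists set0; rewrite measure0.
have [_ _ /(_ h)[N' [mN' N'0 hN']]] := phiY.
exists (N' `|` N); split.
- exact: measurableU.
- rewrite prE; last exact: measurableU.
  congr (_%:E); apply/eqP; rewrite eq_le pr_ge0 andbT.
  by apply: le_trans (pr_leU mu mN' mN) _; rewrite /pr N0 N'0 addr0.
move=> x /not_orP[nN' nN] k; rewrite in_cons => /predU1P[->|khs]; last exact: hN.
by apply: contrapT => hx; apply: nN'; exact: hN'.
Qed.

(** The part of the factor that a shift with another base can imitate: finite-alphabet data over
    finite windows. Both final inequalities are strict so that they survive a limit. *)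
Lemma symbolic_model : ~ (exists y, nu [set y] = 1%E) ->
  (rokhlin_entropy nu b <= 0)%E ->
  exists (T : finType) (f : L -> T) (D : set T) (V W hs : seq G) (r : nat)
    (ell : (G -> T) -> 'I_r.+1) (w : 'I_r.+1 -> R) (E : set (G -> T)) (e : R),
    let s := 2^-1 ^+ (size V).+1 * (e / 2) in
    [/\ forall t, measurable (f @^-1` [set t]), uniq (1%g :: V),
      forall z z', (forall w, w \in W -> z w = z' w) -> ell z = ell z',
      forall z z', (forall h, h \in hs -> ell (translate h z) = ell (translate h z')) ->
        (forall v, v \in V -> z v = z' v) -> E z -> E z' &
      [/\ forall u, 0 < w u, 0 < e,
      - (\sum_u pr mu [set x : G -> L | ell (f \o x) = u] * ln (w u)) + \sum_u w u - 1
        < s ^+ 2 / 8 &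
      pr lambda (f @^-1` D) * pr mu [set x : G -> L | E (f \o x)] + e / 2 <
        pr mu [set x : G -> L | D (f (x 1%g)) /\ E (f \o x)]]].
Proof.
move=> natom rok0.
have [D [V [C [B [e [mD mC uV mB [e0 dep]]]]]]] :=
  dependence_at_identity mulambda sY bY phiY natom.
have [b1 bM mb pb] := bY; have [mphi pphi _] := phiY.
have mpre (B' : set Y) : measurable B' -> measurable (phi @^-1` B').
  by move=> mB'; rewrite -[X in measurable X]setTI; exact: mphi.
(* Half of the excess [e] survives the approximations; a mark at 1 and unmarked places on [V] cost a
   factor 1/2 each. *)
pose s : R := 2^-1 ^+ (size V).+1 * (e / 2).
have s0 : 0 < s by rewrite /s mulr_gt0 ?exprn_gt0 ?invr_gt0 ?divr_gt0.
(* The budget is [s ^+ 2 / 8 = 8 * t]. The labels spend [2 * t], the excess mass of the weights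
   [2 * t] and the approximation of the labels [t]. *)
pose t := s ^+ 2 / 64.
have t0 : 0 < t by rewrite divr_gt0// exprn_gt0.
have rokt : (rokhlin_entropy nu b < t%:E)%E.
  by apply: le_lt_trans rok0 _; rewrite lte_fin.
have [_ [alpha [Palpha gen] <-] Ht] := ereal_inf_lt rokt.
have e80 : 0 < e / 8 by rewrite divr_gt0.
have [sB [B2 [sG sB2 eB]]] := (generating_approximable bY Palpha gen mB).2 _ e80.
have malpha : alpha `<=` measurable by case: Palpha.
have mB2 : measurable B2.
  apply: determined_measurable sB2 => A /sG[h [A' [/malpha mA' ->]]].
  by rewrite -[X in measurable X]setTI; exact: mb.
have [hs [Cs [aCs detB2]]] := translates_determined sG sB2.
have [r [ellY [w [mellY detC w0 w1 costY]]]] := cheap_labels Palpha Ht aCs t0.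
pose Lw := \sum_u `|ln (w u)|.
have Lw0 : 0 <= Lw by exact: sumr_ge0.
(* The first bound lets the label errors at the translates [hs] add up to at most [e / 8]; the
   second keeps the change in cost, at most [eta * Lw], below [t]. *)
pose eta := Num.min (e / 8 / (size hs).+1%:R) (t / (1 + Lw)).
have eta0 : 0 < eta.
  by rewrite lt_min; apply/andP; split; apply: divr_gt0 => //; rewrite ?ltr0n// ltr_pwDl.
have eta1 : (size hs)%:R * eta <= e / 8.
  apply: (@le_trans _ _ ((size hs).+1%:R * (e / 8 / (size hs).+1%:R))).
    by apply: ler_pM; rewrite ?ler_nat ?ler0n ?(ltW eta0)// ge_min lexx.
  by rewrite mulrC divfK// pnatr_eq0.
have eta2 : eta * Lw <= t.
  apply: (@le_trans _ _ (t / (1 + Lw) * (1 + Lw))).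
    apply: ler_pM => //; first exact: ltW.
      by rewrite ge_min lexx orbT.
    by rewrite lerDr.
  by rewrite divfK// gt_eqF// ltr_pwDl.
have mellX u : measurable ((ellY \o phi) @^-1` [set u]).
  exact: (mpre (ellY @^-1` [set u])).
have [Cs1 [W [mCs1 hell]]] := approximate_labels mu mellX eta0.
pose Cs' := D :: map C V ++ Cs1.
have mCs' A : A \in Cs' -> measurable A.
  rewrite in_cons mem_cat => /orP[/eqP ->//|/orP[/mapP[v _ ->]//|]].
  exact: mCs1.
have [|ell [ellW ellN]] := hell Cs' _ mCs'.
  by move=> A AinC; rewrite in_cons mem_cat AinC !orbT.
pose f := signature Cs'.
have mf : forall t, measurable (f @^-1` [set t]) := measurable_signature mCs'.
have fE (A : set L) l : A \in Cs' -> (exists l', A l' /\ f l' = f l) <-> A l.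
  move=> AinC; split; last by move=> Al; exists l.
  by move=> [l' [Al' ll']]; apply/(signature_eq (esym ll') AinC).
pose D' : set _ := [set t | exists l, D l /\ f l = t].
have fD l : D' (f l) <-> D l by apply: fE; rewrite mem_head.
(* The pattern must carry letters on [V] allowed by [C], and labels along [hs] that some point of
   [B2] has. Only letters on [V] and labels enter, so [Edet] is exact although the labels are
   approximate. *)
pose E : set (G -> _) := [set z | (forall v, v \in V -> exists l, C v l /\ f l = z v) /\
  exists y, B2 y /\ forall h, h \in hs -> ellY (b h y) = ell (translate h z)].
have Edet z z' : (forall h, h \in hs -> ell (translate h z) = ell (translate h z')) ->
    (forall v, v \in V -> z v = z' v) -> E z -> E z'.
  move=> h1 h2 [Ez [y [By yz]]]; split; first by move=> v vV; rewrite -h2//; exact: Ez.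
  by exists y; split=> // h hhs; rewrite -h1// yz.
have mE : measurable ([set x : G -> L | E (f \o x)] : set (power_space G L)).
  exact: (measurable_local mf (local_translates ellW Edet)).
have mell u : measurable ([set x : G -> L | ell (f \o x) = u] : set (power_space G L)).
  apply: (measurable_local (W := W) (A := [set z | ell z = u]) mf) => z z' zz' /= <-.
  by apply/esym; exact: ellW.
pose N : set (power_space G L) := [set x : G -> L | ell (f \o x) != ellY (phi x)].
have mN : measurable N.
  have -> : N = ~` [set x | exists2 u, u \in enum 'I_r.+1 &
      (((ellY \o phi) @^-1` [set u]) `&` [set x : G -> L | ell (f \o x) = u]) x].
    apply/seteqP; split=> x /=.
      by move=> /eqP h [u _ [<- /h]].
    move=> h; apply/eqP => xE; apply: h; exists (ellY (phi x)); rewrite ?mem_enum//.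
  by apply: measurableC; apply: measurable_exists => u _; exact: measurableI.
have prN : pr mu N <= eta by exact: ellN.
pose Q : set (power_space G L) := rect V C `&` phi @^-1` B.
have mQ : measurable Q by apply: measurableI; [exact: measurable_rect|exact: mpre].
pose EX : set (power_space G L) := [set x : G -> L | E (f \o x)].
have [N0 [mN0 N00 hN0]] := ae_seq hs.
have mshN h : measurable (bernoulli_shift h @^-1` N) := measurable_shift h mN.
(* Outside this set [E] describes [Q] exactly. Its probability is below [e / 4]: [e / 8] for
   replacing [B] by [B2], [e / 8] for wrong labels, 0 for the failure of equivariance. *)
pose bad : set (power_space G L) := (phi @^-1` (B `+` B2)) `|`
  ([set x | exists2 h, h \in hs & (bernoulli_shift h @^-1` N) x] `|` N0).
have mBB := mpre _ (measurableY mB mB2).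
have mex : measurable [set x : power_space G L | exists2 h, h \in hs & (bernoulli_shift h @^-1` N) x].
  by apply: measurable_exists => h _; exact: mshN.
have mbad : measurable bad by apply: measurableU => //; exact: measurableU.
have prbad : pr mu bad < e / 4.
  apply: le_lt_trans (pr_leU mu mBB (measurableU _ _ mex mN0)) _.
  have h1 : pr mu (phi @^-1` (B `+` B2)) < e / 8.
    by rewrite /pr pphi//; exact: measurableY.
  have h2 := pr_leU mu mex mN0.
  have h3 : pr mu N0 = 0 by rewrite /pr N00.
  have h4 := pr_exists_le mu (fun h (_ : h \in hs) => mshN h).
  have h5 : \sum_(h <- hs) pr mu (bernoulli_shift h @^-1` N) <= (size hs)%:R * eta.
    apply: (@le_trans _ _ (\sum_(h <- hs) eta)).
      by apply: ler_sum => h _; rewrite (pr_shift mulambda).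
    by rewrite big_const_seq count_predT iter_addr_0 mulr_natl.
  lra.
have good x : ~ bad x -> EX x <-> Q x.
  move=> /not_orP[nBB /not_orP[nex nN0]].
  have hell' h : h \in hs -> ell (translate h (f \o x)) = ellY (b h (phi x)).
    move=> hhs; rewrite -(hN0 _ nN0)//; apply/eqP; apply: contra_notT nex => ne.
    by exists h.
  have BB : B2 (phi x) <-> B (phi x).
    split=> hB; apply: contrapT => nB; apply: nBB; [right|left]; by split.
  split.
    move=> [Cx [y [By yx]]]; split.
      by move=> v vV; apply/(fE (C v)); [rewrite in_cons mem_cat map_f ?orbT|exact: Cx].
    apply/BB; apply: detB2 By => h A hhs ACs; have e1 : ellY (b h y) = ellY (b h (phi x)).
      by rewrite yx// hell'.
    by split; apply: detC.
  move=> [Cx Bx]; split.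
    by move=> v vV; exists (x v); split=> //; exact: Cx.
  by exists (phi x); split; [exact/BB|move=> h hhs; rewrite hell'].
have mDx : measurable ([set x : G -> L | D (x 1%g)] : set (power_space G L)).
  exact: measurable_coordinate.
have dq : `|pr mu Q - pr mu EX| < e / 4.
  apply: le_lt_trans (pr_dist mu mQ mE) (le_lt_trans _ prbad).
  apply: pr_le => //; first exact: measurableY.
  by move=> x h; apply: contrapT => /good hx; case: h => -[] /hx.
have dm : `|pr mu ([set x : G -> L | D (x 1%g)] `&` Q) -
    pr mu ([set x : G -> L | D (x 1%g)] `&` EX)| < e / 4.
  have mDQ := measurableI _ _ mDx mQ; have mDE := measurableI _ _ mDx mE.
  apply: le_lt_trans (pr_dist mu mDQ mDE) (le_lt_trans _ prbad).
  apply: pr_le => //; first exact: measurableY.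
  move=> x h; apply: contrapT => /good hx.
  by case: h => -[[Dx /hx h1] h2]; apply: h2.
exists {ffun 'I_(size Cs') -> bool}, f, D', V, W, hs, r, ell, w, E, e; split=> //; split=> //.
  have costX : - (\sum_u pr mu [set x : G -> L | ell (f \o x) = u] * ln (w u)) <=
      - (\sum_u pr nu (ellY @^-1` [set u]) * ln (w u)) + eta * Lw.
    rewrite -!sumrN /Lw mulr_sumr -big_split /=; apply: ler_sum => u _.
    have d1 : `|pr nu (ellY @^-1` [set u]) - pr mu [set x : G -> L | ell (f \o x) = u]| <= eta.
      have -> : pr nu (ellY @^-1` [set u]) = pr mu ((ellY \o phi) @^-1` [set u]).
        by rewrite /pr -pphi.
      apply: le_trans (pr_dist mu (mellX u) (mell u)) (le_trans _ prN).
      apply: pr_le => //; first exact: measurableY.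
      move=> x /= [[xu nu']|[xu nu']]; apply/eqP => xx.
        by apply: nu'; rewrite xx.
      by apply: nu'; rewrite -xx.
    rewrite -lerBlDl opprK addrC -mulrBl; apply: le_trans (ler_norm _) _.
    by rewrite normrM ler_wpM2r.
  have sE : s ^+ 2 / 8 = 8 * t.
    by rewrite /t; field.
  rewrite -/s sE; set S1 := \sum_u _ * _ in costX *; set S2 := \sum_u w u in w1 *.
  set S3 := \sum_u _ * _ in costX costY; lra.
have -> : pr lambda (f @^-1` D') = pr lambda D.
  by congr (pr lambda _); apply/seteqP; split=> l /fD.
have -> : [set x : G -> L | D' (f (x 1%g)) /\ E (f \o x)] =
    [set x : G -> L | D (x 1%g)] `&` EX.
  by apply/seteqP; split=> x [/fD Dx Ex]; split=> //; exact/fD.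
rewrite -/EX; move: dep; rewrite -/Q; move: dq dm.
have l0 := pr_ge0 lambda D; have l1 := pr_le1 lambda mD.
set q := pr mu Q; set q' := pr mu EX; set m := pr mu _; set m' := pr mu _.
rewrite !ltr_norml => /andP[? ?] /andP[? ?] ?; nra.
Qed.

End SymbolicModel.

(** * Finite models and the contradiction *)

Section FiniteModel.
Context (R : realType) (G : groupType).
Hypothesis Gcount : countable [set: G].

Lemma pr_preimage_sum d (L : measurableType d) (lambda : probability L R)
    (T : finType) (f : L -> T) (D : set T) :
  (forall t, measurable (f @^-1` [set t])) ->
  pr lambda (f @^-1` D) =
    \sum_t if `[< D t >] then pr lambda (f @^-1` [set t]) else 0.
Proof.
move=> mf; rewrite (pr_sum_fibers lambda mf); last exact: measurable_fibers.
apply: eq_bigr => t _; case: asboolP => Dt.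
  by congr (pr lambda _); apply/seteqP; split=> [l []//|l /= lt]; split=> //=; rewrite lt.
rewrite (_ : _ `&` _ = set0) ?pr_set0//; apply/seteqP; split=> l //= -[Dl lt].
by apply: Dt; rewrite -lt.
Qed.

Variables (T : finType) (V W hs : seq G) (r : nat) (ell : (G -> T) -> 'I_r.+1).
Variables (w : 'I_r.+1 -> R) (D : set T) (E : set (G -> T)).
Hypothesis uV : uniq (1%g :: V).
Hypothesis ellW : forall z z', (forall w, w \in W -> z w = z' w) -> ell z = ell z'.
Hypothesis Edet : forall z z',
  (forall h, h \in hs -> ell (translate h z) = ell (translate h z')) ->
  (forall v, v \in V -> z v = z' v) -> E z -> E z'.
Hypothesis w0 : forall u, 0 < w u.

Let localE : local (V ++ [seq (h^-1 * w)%g | h <- hs, w <- W]) E.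
Proof. exact: local_translates ellW Edet. Qed.

Let DE : set (G -> T) := [set z | D (z 1%g) /\ E z].

Let localDE : local (1%g :: (V ++ [seq (h^-1 * w)%g | h <- hs, w <- W])) DE.
Proof.
move=> z z' zz' [Dz Ez]; split; first by rewrite -zz' ?mem_head.
by apply: localE Ez => g gV; apply: zz'; rewrite in_cons gV orbT.
Qed.

Let local_ell u : local W [set z | ell z = u].
Proof. by move=> z z' zz' /= <-; apply/esym; exact: ellW. Qed.

Section Coded.
Variables (A : finZmodType) (f : A -> T).
Local Notation K := (A * bool)%type.
Local Notation L := (@finite_space K (0, false)).
Variables (lambda : probability L R) (mu : probability (power_space G L) R).
Hypotheses (unif : uniform_measure lambda) (mulambda : is_power_measure lambda mu).
Hypothesis rokhlin : rokhlin_entropy mu (@bernoulli_shift G _ L) = base_entropy lambda.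
Let F (k : L) : T := f (k : K).1.

(** Labels and [E] read only the [A]-components, so the marks are independent of them: both sides of
    the gap shrink by the same factor and its size [e / 2] becomes the deviation [s] of
    [coding_entropy]. *)
Lemma finite_model_bound (e : R) : 0 < e ->
  pr lambda (F @^-1` D) * pr mu [set x : G -> L | E (F \o x)] + e / 2 <=
    pr mu [set x : G -> L | DE (F \o x)] ->
  (2^-1 ^+ (size V).+1 * (e / 2)) ^+ 2 / 8 <=
    - (\sum_u pr mu [set x : G -> L | ell (F \o x) = u] * ln (w u)) + \sum_u w u - 1.
Proof.
move=> e0 He.
have mF t : measurable (F @^-1` [set t]) by [].
have m2 c : measurable ((fun k : L => (k : K).2) @^-1` [set c]) by [].
pose DA : pred A := fun a => `[< D (f a) >].
have rhoE : pr lambda (F @^-1` D) = #|DA|%:R / #|A|%:R.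
  rewrite -(uniform_pr_fst DA unif); congr (pr lambda _); apply/seteqP.
  by split=> k /asboolP.
have half t c : pr lambda (F @^-1` [set t] `&` (fun k : L => (k : K).2) @^-1` [set c]) =
    pr lambda (F @^-1` [set t]) / 2.
  pose B : pred A := fun a => f a == t.
  rewrite (_ : F @^-1` [set t] `&` _ = (fun k : K => B k.1 && (k.2 == c))).
    rewrite (uniform_pr_fst_snd B c unif) -(uniform_pr_fst B unif); congr (pr lambda _ / 2).
    by apply/seteqP; split=> k /eqP.
  apply/seteqP; split=> k.
    by move=> [/= h1 h2]; apply/andP; split; apply/eqP.
  by move=> /andP[/eqP h1 /eqP h2].
(* The pattern [v == 1] prescribes the mark at 1 and its absence on [V] together, as [uV] keeps 1
   out of [V]. *)
have m1 := pr_local_marks (fun v : G => v == 1%g) mulambda mF m2 half uV localE.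
have m3 := pr_local_marks (fun v : G => v == 1%g) mulambda mF m2 half uV localDE.
pose ellX (x : power_space G L) := ell (F \o x).
pose EX : set (power_space G L) := [set x : G -> L | E (F \o x)].
have mellX u : measurable (ellX @^-1` [set u]).
  exact: (measurable_local mF (local_ell (u := u))).
have mEX : measurable EX by exact: measurable_local mF localE.
have EXdet (x x' : power_space G L) :
    (forall h, h \in hs -> ellX (bernoulli_shift h x) = ellX (bernoulli_shift h x')) ->
    (forall v, v \in V -> x v = x' v) -> EX x -> EX x'.
  move=> h1 h2; apply: Edet; first by move=> h /h1.
  by move=> v vV /=; rewrite h2.
have marksE : marked_event V EX = EX `&`
    [set x : G -> L | forall v, v \in 1%g :: V -> ((x v) : K).2 = (v == 1%g)].
  apply/seteqP; split=> x [Ex].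
    move=> [m10 mV]; split=> // v; rewrite in_cons => /predU1P[->|vV]; first by rewrite eqxx.
    by rewrite mV//; apply/esym/negbTE; apply: contraTneq vV => ->; case/andP: uV.
  move=> h; split=> //; split; first by rewrite /= h ?mem_head ?eqxx.
  move=> v vV; rewrite h ?in_cons ?vV ?orbT//; apply/negbTE.
  by apply: contraTneq vV => ->; case/andP: uV.
have [j hj] := exists_recoding_shift mu V DA mEX.
apply: (coding_entropy unif mulambda rokhlin mellX mEX EXdet w0 _ hj).
  by rewrite mulr_gt0 ?exprn_gt0 ?invr_gt0 ?divr_gt0.
have -> : marked_event V EX `&` [set x : power_space G L | DA ((x : G -> K) 1%g).1] =
    [set x : G -> L | DE (F \o x)] `&`
    [set x : G -> L | forall v, v \in 1%g :: V -> ((x v) : K).2 = (v == 1%g)].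
  rewrite marksE; apply/seteqP; split=> x.
    by move=> [[Ex mx] /asboolP Dx].
  by move=> [[Dx Ex] mx]; split=> //; exact/asboolP.
rewrite marksE m1 m3 -rhoE mulrCA -mulrDr.
by rewrite ler_pM2l// exprn_gt0// invr_gt0.
Qed.

End Coded.

(** Cost and gap are continuous in finitely many local probabilities, so for some base
    ['I_n.+1 * bool] the cost is still too small and the gap still large enough, against
    [finite_model_bound]. *)
Lemma finite_model_contradiction d (L : measurableType d)
    (lambda : probability L R) (mu : probability (power_space G L) R)
    (f : L -> T) (e : R) :
  (forall (d : measure_display) (L : measurableType d)
        (lambda : probability L R) (mu : probability (power_space G L) R),
      standard_borel R L -> is_power_measure lambda mu ->
      rokhlin_entropy mu (@bernoulli_shift G d L) = base_entropy lambda) ->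
  is_power_measure lambda mu -> (forall t, measurable (f @^-1` [set t])) -> 0 < e ->
  - (\sum_u pr mu [set x : G -> L | ell (f \o x) = u] * ln (w u)) + \sum_u w u - 1
    < (2^-1 ^+ (size V).+1 * (e / 2)) ^+ 2 / 8 ->
  ~ (pr lambda (f @^-1` D) * pr mu [set x : G -> L | E (f \o x)] + e / 2 <
      pr mu [set x : G -> L | D (f (x 1%g)) /\ E (f \o x)]).
Proof.
move=> HRok pm mf e0 cost gap.
have [|fn cfn] := rational_labels (fun t => pr_ge0 lambda (f @^-1` [set t])).
  rewrite -(pr_setT lambda) (pr_sum_fibers lambda mf measurableT).
  by apply: eq_bigr => t _; rewrite setTI.
pose K n := ('I_n.+1 * bool)%type.
pose Ln n := @finite_space (K n) (0, false).
pose H n := @uniform_power_measure R G (K n) (0, false) Gcount.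
pose lm n : probability (Ln n) R := sval (cid (H n)).
pose mm n : probability (power_space G (Ln n)) R := sval (cid (svalP (cid (H n)))).
have unif n : uniform_measure (lm n) by case: (svalP (cid (svalP (cid (H n))))).
have pmn n : is_power_measure (lm n) (mm n) by case: (svalP (cid (svalP (cid (H n))))).
pose Fn n (k : Ln n) : T := fn n (k : K n).1.
have mFn n t : measurable (@Fn n @^-1` [set t]) by [].
have law t : pr (lm n) (@Fn n @^-1` [set t]) @[n --> \oo] --> pr lambda (f @^-1` [set t]).
  rewrite (_ : (fun n => _) = fun n => #|[pred k | fn n k == t]|%:R / n.+1%:R); first exact: cfn.
  apply/funext => n; rewrite -[X in _ / X%:R]card_ord -(uniform_pr_fst _ (unif n)).
  by congr (pr _ _); apply/seteqP; split=> k /eqP.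
have cvgE := cvg_pr_local pm pmn mf mFn law localE.
have cvgDE := cvg_pr_local pm pmn mf mFn law localDE.
have cvg_ell u := cvg_pr_local pm pmn mf mFn law (local_ell (u := u)).
have cvgD : pr (lm n) (@Fn n @^-1` D) @[n --> \oo] --> pr lambda (f @^-1` D).
  rewrite (pr_preimage_sum lambda D mf).
  rewrite (_ : (fun n => _) = fun n =>
      \sum_t if `[< D t >] then pr (lm n) (@Fn n @^-1` [set t]) else 0); last first.
    by apply/funext => n; exact: pr_preimage_sum.
  by apply: cvg_sum_seq => t; case: ifP => _; [exact: law|exact: cvg_cst].
have cvgCost : - (\sum_u pr (mm n) [set x : G -> Ln n | ell (@Fn n \o x) = u] * ln (w u)) @[n --> \oo] -->
    - (\sum_u pr mu [set x : G -> L | ell (f \o x) = u] * ln (w u)).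
  apply: cvgN; apply: cvg_sum_seq => u; apply: cvgM; [exact: cvg_ell|exact: cvg_cst].
have cvgGap : pr (lm n) (@Fn n @^-1` D) * pr (mm n) [set x : G -> Ln n | E (@Fn n \o x)] -
    pr (mm n) [set x : G -> Ln n | DE (@Fn n \o x)] @[n --> \oo] -->
    pr lambda (f @^-1` D) * pr mu [set x : G -> L | E (f \o x)] -
    pr mu [set x : G -> L | DE (f \o x)].
  by apply: cvgB => //; apply: cvgM.
set s8 := _ ^+ 2 / 8 in cost.
have cost' : - (\sum_u pr mu [set x : G -> L | ell (f \o x) = u] * ln (w u)) <
  s8 - \sum_u w u + 1 by move: cost; lra.
have gap' : pr lambda (f @^-1` D) * pr mu [set x : G -> L | E (f \o x)] -
    pr mu [set x : G -> L | DE (f \o x)] < - (e / 2).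
  by move: gap; rewrite -/DE; lra.
have near1 := cvgr_lt _ cvgCost _ cost'.
have near2 := cvgr_lt _ cvgGap _ gap'.
have [n [h1 h2]] := filter_ex (filterI (near1 _) (near2 _)).
have := @finite_model_bound 'I_n.+1 (fn n) (lm n) (mm n) (unif n) (pmn n)
  (HRok _ _ _ _ (finite_space_standard R (0, false)) (pmn n)) e e0.
move: h1 h2; rewrite -/s8 /= => h1 h2 h3.
have := h3 _; move: h1 h2 {h3}.
set c := - _; set q := _ * _; set m := pr (mm n) _ => h1 h2 h3.
suff : s8 <= c + \sum_u w u - 1 by lra.
by apply: h3; lra.
Qed.

End FiniteModel.

Theorem corollary1p7 (R : realType) (G : groupType)
    (Gcount : countable [set: G]%classic)
    (Ginf : infinite_set [set: G]%classic)
    (HRok : forall (d : measure_display) (L : measurableType d)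
        (lambda : probability L R) (mu : probability (power_space G L) R),
      standard_borel R L -> is_power_measure lambda mu ->
      rokhlin_entropy mu (@bernoulli_shift G d L) = base_entropy lambda) :
  forall (d : measure_display) (L : measurableType d)
      (lambda : probability L R) (mu : probability (power_space G L) R),
    standard_borel R L -> is_power_measure lambda mu ->
    completely_positive_rokhlin_entropy mu (@bernoulli_shift G d L).
Proof.
move=> d L lambda mu _ pm; split; first exact: bernoulli_ergodic pm Ginf.
move=> d' Y nu b phi sY bY phiY natom; rewrite ltNge; apply/negP => rok0.
have [T [f [D [V [W [hs [r [ell [w [E [e [mf uV ellW Edet [w0 e0 cost gap]]]]]]]]]]]]] :=
  symbolic_model pm sY bY phiY natom rok0.
exact: (finite_model_contradiction Gcount uV ellW Edet w0 HRok pm mf e0 cost gap).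
Qed.
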